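(* Let $\Gamma\curvearrowright X$ be a topologically free action of a countably infinite amenable group on the Cantor set. Then every subgroup of the topological full group $[[\Gamma\curvearrowright X]]$ containing the alternating group $\mathsf{A}(\Gamma,X)$ has property Gamma.
   Context: Acting groups are discrete and act by homeomorphisms. An action is topologically free if the set of points with trivial stabilizer is dense. For an action $\Gamma\curvearrowright X$, written $(s,x)\mapsto sx$, the topological full group $[[\Gamma\curvearrowright X]]$ is the group of all homeomorphisms $T:X\to X$ for which there exist a clopen partition $\{P_1,\dots,P_n\}$ of $X$ and $s_1,\dots,s_n\in\Gamma$ such that $Tx=s_ix$ for every $i$ and every $x\in P_i$. The alternating group $\mathsf{A}(\Gamma,X)$ is the subgroup of $[[\Gamma\curvearrowright X]]$ generated by the images $\varphi(\mathsf{A}_3)$ of the alternating group $\mathsf{A}_3$ on $\{1,2,3\}$, where $\varphi$ ranges over all group homomorphisms from the symmetric group $\mathsf{S}_3$ to $[[\Gamma\curvearrowright X]]$ for which there are pairwise disjoint clopen sets $A_1,A_2,A_3\subseteq X$ such that for every $\sigma\in\mathsf{S}_3$ the homeomorphism $\varphi(\sigma)$ is the identity off $A_1\sqcup A_2\sqcup A_3$ and, for each $i=1,2,3$, acts on $A_i$ as some element of $\Gamma$ with image $A_{\sigma(i)}$. A II$_1$ factor $M$ with trace $\tau$ and $2$-norm $\|a\|_2=\tau(a^*a)^{1/2}$ has property Gamma if for every $\varepsilon>0$ and finite set $\Omega\subseteq M$ there exists a unitary $u\in M$ with $\tau(u)=0$ such that $\|[a,u]\|_2<\varepsilon$ for all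 $a\in\Omega$. A countable discrete group $G$ has property Gamma if it is ICC (it is infinite and every nonidentity conjugacy class is infinite) and its group von Neumann algebra, which is then a II$_1$ factor, has property Gamma. *)

(* Defs.v *)
From HB Require Import structures.
From mathcomp Require Import all_boot all_order all_algebra all_fingroup all_solvable.
From mathcomp Require Import complex.
From mathcomp Require Import mathcomp_extra boolp classical_sets functions.
From mathcomp Require Import fsbigop cardinality reals ereal topology normedtype.
From mathcomp Require Import numfun esum cantor.
From mathcomp Require Import ring.

Set Implicit Arguments.
Unset Strict Implicit.
Unset Printing Implicit Defensive.

Import Order.TTheory GRing.Theory Num.Theory.
Import numFieldNormedType.Exports.
Import ComplexField.Normc.

Local Open Scope classical_set_scope.
Local Open Scope ring_scope.
Local Open Scope complex_scope.

Definition is_subgroup (G : groupType) (H : set G) : Prop :=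
  group_closed (mem H).

Definition subgroup_generated (G : groupType) (S : set G) : set G :=
  \bigcap_(H in [set H | is_subgroup H /\ S `<=` H]) H.

Definition subgroup_type (G : groupType) (H : set G) (_ : is_subgroup H) : Type :=
  {x : G | x \in H}.

Section SubgroupType.
Variables (G : groupType) (H : set G) (HG : is_subgroup H).

HB.instance Definition _ := SubType.on (subgroup_type HG).
HB.instance Definition _ := [Choice of subgroup_type HG by <:].
HB.instance Definition _ :=
  SubChoice_isSubGroup.Build G (fun x : G => x \in H) (subgroup_type HG) HG.

End SubgroupType.

Record homeo (X : topologicalType) := Homeo {
  homeo_fun :> X -> X;
  homeo_inv : X -> X;
  homeo_funK : cancel homeo_fun homeo_inv;
  homeo_invK : cancel homeo_inv homeo_fun;
  homeo_fun_continuous : continuous homeo_fun;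
  homeo_inv_continuous : continuous homeo_inv }.

HB.instance Definition _ (X : topologicalType) := gen_eqMixin (homeo X).
HB.instance Definition _ (X : topologicalType) := gen_choiceMixin (homeo X).

Section HomeoGroup.
Variable X : topologicalType.
Implicit Types S T : homeo X.

Lemma homeo_ext S T : (forall x, S x = T x) -> S = T.
Proof.
case: S T => [f f' fK f'K fc f'c] [g g' gK g'K gc g'c] /= fg.
have {}fg : f = g by apply/funext.
subst g.
have f'g' : f' = g' by apply/funext => x; rewrite -{1}(g'K x) fK.
by subst g'; congr Homeo; exact: Prop_irrelevance.
Qed.

Definition homeo_one : homeo X :=
  @Homeo X idfun idfun (fun=> erefl) (fun=> erefl)
    (fun=> cvg_id) (fun=> cvg_id).

Definition homeo_mul S T : homeo X :=
  @Homeo X (S \o T) (homeo_inv T \o homeo_inv S)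
    (can_comp (homeo_funK S) (homeo_funK T))
    (can_comp (homeo_invK T) (homeo_invK S))
    (fun x => continuous_comp (@homeo_fun_continuous _ T x)
                              (@homeo_fun_continuous _ S (T x)))
    (fun x => continuous_comp (@homeo_inv_continuous _ S x)
                              (@homeo_inv_continuous _ T (homeo_inv S x))).

Definition homeo_invg S : homeo X :=
  @Homeo X (homeo_inv S) S (homeo_invK S) (homeo_funK S)
    (@homeo_inv_continuous _ S) (@homeo_fun_continuous _ S).

Lemma homeo_mulA : associative homeo_mul.
Proof. by move=> S T U; exact: homeo_ext. Qed.

Lemma homeo_mul1 : left_id homeo_one homeo_mul.
Proof. by move=> S; exact: homeo_ext. Qed.

Lemma homeo_mulr1 : right_id homeo_one homeo_mul.
Proof. by move=> S; exact: homeo_ext. Qed.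

Lemma homeo_mulV : left_inverse homeo_one homeo_invg homeo_mul.
Proof. by move=> S; apply: homeo_ext => x /=; rewrite homeo_funK. Qed.

Lemma homeo_mulrV : right_inverse homeo_one homeo_invg homeo_mul.
Proof. by move=> S; apply: homeo_ext => x /=; rewrite homeo_invK. Qed.

HB.instance Definition _ := isGroup.Build (homeo X)
  homeo_mulA homeo_mul1 homeo_mulr1 homeo_mulV homeo_mulrV.

End HomeoGroup.

(* An action by homeomorphisms is a homomorphism [alpha] into [homeo X]; the
   point [alpha s x] is usually written sx. *)

Section Actions.
Variables (Gamma : groupType) (X : topologicalType).
Variable alpha : {multiplicative Gamma -> homeo X}.

Definition topologically_free : Prop :=
  dense [set x : X | forall s : Gamma, alpha s x = x -> s = 1%g].

Definition full_group : set (homeo X) :=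
  [set T | exists (n : nat) (P : 'I_n -> set X) (s : 'I_n -> Gamma),
    [/\ partition [set: 'I_n] P [set: X],
        forall i, clopen (P i)
      & forall i x, P i x -> T x = alpha (s i) x]].

(* The product [sigma * tau] of permutations applies [sigma] first, whereas
   the product in [homeo X] is composition of functions; hence the order of
   the factors in the homomorphism property. *)
Definition dynamical_S3 (phi : 'S_3 -> homeo X) : Prop :=
  [/\ forall sigma, full_group (phi sigma),
      forall sigma tau : 'S_3, phi (sigma * tau)%g = (phi tau * phi sigma)%g
    & exists A : 'I_3 -> set X,
      [/\ forall i, clopen (A i),
          trivIset [set: 'I_3] A,
          forall (sigma : 'S_3) x, ~ (\bigcup_i A i) x -> phi sigma x = x
        & forall (sigma : 'S_3) i,
            (exists s : Gamma, forall x, A i x -> phi sigma x = alpha s x) /\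
            phi sigma @` A i = A (sigma i)]].

Definition dynamical_alternating_group : set (homeo X) :=
  subgroup_generated [set T | exists2 phi, dynamical_S3 phi &
                     exists2 sigma, sigma \in ('Alt_('I_3))%g & T = phi sigma].

End Actions.

(* Left-invariant means on the bounded real functions; the values of [m] on
   unbounded functions are irrelevant. *)

Definition is_invariant_mean (R : realType) (Gamma : groupType)
    (m : (Gamma -> R) -> R) : Prop :=
  let bdd (f : Gamma -> R) := exists M : R, forall t, `|f t| <= M in
  [/\ forall (c : R) f g, bdd f -> bdd g ->
        m (fun t => c * f t + g t) = c * m f + m g,
      forall f, bdd f -> (forall t, 0 <= f t) -> 0 <= m f,
      m (fun=> 1) = 1
    & forall (s : Gamma) f, bdd f -> m (fun t => f (s^-1 * t)%g) = m f].

Definition amenable (R : realType) (Gamma : groupType) : Prop :=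
  exists m : (Gamma -> R) -> R, is_invariant_mean m.

Section Ell2.
Variables (R : realType) (I : choiceType).

(* Unordered sums over I; meaningful for absolutely summable families only. *)
Definition rsum (f : I -> R) : R :=
  fine (\esum_(i in [set: I]) (EFin \o f)^\+%E i) -
  fine (\esum_(i in [set: I]) (EFin \o f)^\-%E i).

Definition csum (f : I -> R[i]) : R[i] :=
  rsum (fun i => complex.Re (f i)) +i* rsum (fun i => complex.Im (f i)).

Definition square_summable (f : I -> R[i]) : Prop :=
  (\esum_(i in [set: I]) (normc (f i) ^+ 2)%:E < +oo)%E.

Definition ell2_pred : {pred I -> R[i]} := fun f => `[< square_summable f >].

Lemma normcD (x y : R[i]) : normc (x + y) <= normc x + normc y.
Proof. by have := ler_normD x y; rewrite -rmorphD /= lecR. Qed.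

Lemma ell2_submod_closed : submod_closed ell2_pred.
Proof.
have esumZ (c : R) (f : I -> R) : 0 <= c -> (forall i, 0 <= f i) ->
    (\esum_(i in [set: I]) (f i)%:E < +oo)%E ->
    (\esum_(i in [set: I]) (c * f i)%:E < +oo)%E.
  move=> c0 f0 fi; set s := (\esum_(i in _) _)%E in fi.
  have s0 : (0 <= s)%E by apply: esum_ge0 => i _; rewrite lee_fin.
  apply: (@le_lt_trans _ _ (c%:E * s)%E); last first.
    by case: s fi s0 => [r| |] // _ _; rewrite -EFinM ltry.
  apply: ge_ereal_sup => _ [F [Ffin FI] <-].
  under eq_fsbigr do rewrite EFinM.
  rewrite -ge0_mule_fsumr; last by move=> i; rewrite lee_fin.
  apply: lee_wpmul2l; first by rewrite lee_fin.
  by apply: ereal_sup_ubound; exists F.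
split=> [|a f g /asboolP fS /asboolP gS]; apply/asboolP.
  rewrite /square_summable esum1 ?ltry // => i _.
  by rewrite (_ : (0 : I -> R[i]) i = 0) // normc0 expr0n.
rewrite /square_summable.
have nsq0 (h : I -> R[i]) i : 0 <= normc (h i) ^+ 2 by rewrite sqr_ge0.
apply: (@le_lt_trans _ _ (\esum_(i in [set: I])
  (((2 * normc a ^+ 2) * normc (f i) ^+ 2)%:E
   + (2 * normc (g i) ^+ 2)%:E))%E).
  apply: le_esum => i _; rewrite -EFinD lee_fin.
  have nn (z : R[i]) : 0 <= normc z by case: z => u v; exact: sqrtr_ge0.
  have -> : (a *: f + g) i = a * f i + g i by [].
  have h := normcD (a * f i) (g i); rewrite normcM in h.
  apply: (@le_trans _ _ ((normc a * normc (f i) + normc (g i)) ^+ 2)).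
    by rewrite ler_sqr ?nnegrE ?addr_ge0 ?mulr_ge0.
  set u := normc a * _; set v := normc (g i).
  rewrite -mulrA -exprMn -/u -mulrDr -subr_ge0.
  have -> : 2 * (u ^+ 2 + v ^+ 2) - (u + v) ^+ 2 = (u - v) ^+ 2.
    by ring.
  exact: sqr_ge0.
have c0 : 0 <= 2 * normc a ^+ 2 by apply: mulr_ge0 => //; exact: sqr_ge0.
rewrite esumD => [|i _|i _].
- by apply: lte_add_pinfty; apply: esumZ.
- by rewrite lee_fin; apply: mulr_ge0.
- by rewrite lee_fin; apply: mulr_ge0.
Qed.

HB.instance Definition _ :=
  GRing.isSubmodClosed.Build R[i] (I -> R[i]) ell2_pred ell2_submod_closed.

Record ell2 := Ell2 { ell2_fun :> I -> R[i]; _ : ell2_fun \in ell2_pred }.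

HB.instance Definition _ := [isSub for ell2_fun].
HB.instance Definition _ := [Choice of ell2 by <:].
HB.instance Definition _ := [SubChoice_isSubLmodule of ell2 by <:].

Definition inner (xi eta : ell2) : R[i] :=
  csum (fun i => xi i * conjc (eta i)).

Definition ell2_norm (xi : ell2) : R := Num.sqrt (complex.Re (inner xi xi)).

Lemma delta_subproof (i : I) :
  (fun j => (j == i)%:R : R[i]) \in ell2_pred.
Proof.
apply/asboolP; rewrite /square_summable.
rewrite (_ : (fun _ => _) = (fun j => if j \in [set i] then 1%:E else 0%E)).
  by rewrite -esum_mkcond esum_set1 ?lee01 ?ltry.
apply/funext => j; have [->|ji] := eqVneq j i.
  by rewrite mem_set// normc1 expr1n.
by rewrite memNset ?normc0 ?expr0n//; exact/eqP.
Qed.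

Definition delta (i : I) : ell2 := Ell2 (delta_subproof i).

(* Bounded operators are maps [ell2 -> ell2] satisfying this predicate. *)
Definition bounded_operator (T : ell2 -> ell2) : Prop :=
  linear T /\ exists M : R, forall xi, ell2_norm (T xi) <= M * ell2_norm xi.

Definition is_adjoint (T S : ell2 -> ell2) : Prop :=
  bounded_operator S /\
  forall xi eta, inner (T xi) eta = inner xi (S eta).

(* The adjoint of a bounded operator, which exists and is unique; the default
   value is irrelevant. *)
Definition adjoint (T : ell2 -> ell2) : ell2 -> ell2 :=
  xget (fun=> 0) [set S | is_adjoint T S].

Definition unitary_operator (u : ell2 -> ell2) : Prop :=
  [/\ bounded_operator u, adjoint u \o u = id & u \o adjoint u = id].

Definition op_commutator (a b : ell2 -> ell2) : ell2 -> ell2 :=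
  (a \o b) \- (b \o a).

Definition commutant (S : set (ell2 -> ell2)) : set (ell2 -> ell2) :=
  [set T | bounded_operator T /\ forall a, S a -> T \o a = a \o T].

Definition two_norm (tau : (ell2 -> ell2) -> R[i]) (a : ell2 -> ell2) : R :=
  Num.sqrt (complex.Re (tau (adjoint a \o a))).

(* Meaningful when M is a II_1 factor with trace tau. *)
Definition factor_property_Gamma (M : set (ell2 -> ell2))
    (tau : (ell2 -> ell2) -> R[i]) : Prop :=
  forall (eps : R) (Omega : set (ell2 -> ell2)),
    0 < eps -> finite_set Omega -> Omega `<=` M ->
  exists u, [/\ M u, unitary_operator u, tau u = 0 &
    forall a, Omega a -> two_norm tau (op_commutator a u) < eps].

End Ell2.

Section GroupVonNeumannAlgebra.
Variables (R : realType) (G : groupType).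

Lemma left_regular_subproof (g : G) (xi : ell2 R G) :
  (fun x => xi (g^-1 * x)%g) \in @ell2_pred R G.
Proof.
case: xi => f /= /asboolP fS; apply/asboolP.
rewrite /square_summable in fS *.
rewrite (@reindex_esum _ _ _ setT setT (fun x => g * x)%g)//.
- by under eq_esum do rewrite mulKg.
- split=> // [x y _ _ /mulgI//|y _].
  by exists (g^-1 * y)%g; rewrite ?mulVKg.
Qed.

Definition left_regular (g : G) (xi : ell2 R G) : ell2 R G :=
  Ell2 (left_regular_subproof g xi).

(* The von Neumann algebra on l^2(G) generated by the left regular
   representation, as a double commutant *)
Definition group_vN : set (ell2 R G -> ell2 R G) :=
  commutant (commutant (range left_regular)).

Definition group_trace (a : ell2 R G -> ell2 R G) : R[i] :=
  inner (a (delta R 1%g)) (delta R 1%g).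

End GroupVonNeumannAlgebra.

Definition ICC (G : groupType) : Prop :=
  infinite_set [set: G] /\
  forall g : G, g <> 1%g -> infinite_set (range (fun h : G => g ^ h)%g).

(* For an ICC group the group von Neumann algebra is a II_1 factor. *)
Definition property_Gamma (R : realType) (G : groupType) : Prop :=
  [/\ countable [set: G], ICC G
    & factor_property_Gamma (@group_vN R G) (@group_trace R G)].

(* Main.v *)
(** Let [x0] be a point with trivial stabilizer.  A finite set [E] of elements of
    the group moves the points of the orbit of [x0] by left multiplications from
    a finite set [K].  Take a finite set [F] of odd size that is almost
    invariant under [K], and four elements [t1, t2, t3, t4] such that the
    cocycles of the elements of [E] at [s ti x0], [s \in F], do not depend on
    [i].  For a small clopen set [B] around [x0], the maps exchanging [s t1 B]
    with [s t2 B] and [s t3 B] with [s t4 B] are products of two 3-cycles; they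
    are commuting involutions [h s], and an element [g] of [E] conjugates [h s]
    to [h (sigma s)], where [sigma F] differs little from [F].  Since [#|F|] is
    odd, the majority vote of the involutions [h s], [s \in F], is a self-adjoint
    unitary [U] of trace zero in the group algebra.  Conjugation by [g] turns it
    into the majority vote over [sigma F], which is close to [U] in 2-norm because
    majority is stable under noise.

    To pass from group elements to an operator [a] of the von Neumann algebra,
    let [V] be the version of [U] for the right regular representation: it
    commutes with [a], so [[a, U]] maps [delta 1] to [(V - U) (a (delta 1))], and
    [a (delta 1)] is approximated by a finitely supported vector. *)

Require Import Defs.
From HB Require Import structures.
From mathcomp Require Import all_boot all_order all_algebra all_fingroup all_solvable.
From mathcomp Require Import complex.
From mathcomp Require Import mathcomp_extra boolp classical_sets functions.
From mathcomp Require Import fsbigop cardinality reals ereal topology normedtype.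
From mathcomp Require Import numfun esum cantor.
From mathcomp Require Import ring lra zify.

Set Implicit Arguments.
Unset Strict Implicit.
Unset Printing Implicit Defensive.

Import Order.TTheory GRing.Theory Num.Theory.
Local Open Scope classical_set_scope.
Local Open Scope ring_scope.

(** * Sums of real families and the Hilbert space of square-summable families *)

Section RealSums.
Variables (R : realType) (I : choiceType).
Implicit Types f g p q : I -> R.

(** Equal cocycles keep the pairs in step: [g] sends [s ti B] to [k s ti B] with [k] independent of
    [i], hence acts on the index [s] alone. Suitable [ti] exist by pigeonhole, since the cocycles
    form one of finitely many patterns and the acting group is infinite. The unitary is a function
    of commuting involutions, and its coefficients on their products are the Walsh coefficients of
    that function. Values in signs give a self-adjoint unitary, mean zero gives trace zero. The
    function must also be symmetric in the elements of [F] and insensitive to replacing a small part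
    of [F]: the product of all signs fails the last demand, majority meets it once [F] is large.
    Amenability is stated through an invariant mean, so the Folner sets have to be extracted by
    duality: without them there would be a bounded flow on a Cayley graph with a uniform gain at
    every vertex, and the mean forbids it. *)

Lemma maxB0 (a : R) : Num.max a 0 - Num.max (- a) 0 = a.
Proof.
have [a0|/ltW a0] := leP a 0.
  by rewrite max_l ?oppr_ge0// sub0r opprK.
by rewrite max_r ?oppr_le0// subr0.
Qed.

Definition nnsummable p :=
  (forall i, 0 <= p i) /\ (\esum_(i in [set: I]) (p i)%:E < +oo)%E.

Lemma nnsummable_fin p : nnsummable p ->
  (\esum_(i in [set: I]) (p i)%:E)%E \is a fin_num.
Proof.
move=> [p0 ps]; rewrite ge0_fin_numE//.
by apply: esum_ge0 => i _; rewrite lee_fin.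
Qed.

Definition nnsum p : R := fine (\esum_(i in [set: I]) (p i)%:E)%E.

Lemma nnsum_ge0 p : nnsummable p -> 0 <= nnsum p.
Proof. by move=> [p0 _]; apply/fine_ge0/esum_ge0 => i _; rewrite lee_fin. Qed.

Lemma nnsumD p q : nnsummable p -> nnsummable q ->
  nnsummable (p \+ q) /\ nnsum (p \+ q) = nnsum p + nnsum q.
Proof.
move=> ps qs; have [p0 _] := ps; have [q0 _] := qs.
have E : (\esum_(i in [set: I]) ((p \+ q) i)%:E =
  \esum_(i in [set: I]) (p i)%:E + \esum_(i in [set: I]) (q i)%:E)%E.
  under eq_esum do rewrite EFinD.
  by rewrite esumD// => i _; rewrite lee_fin.
split; last by rewrite /nnsum E fineD// nnsummable_fin.
split=> [i|]; first exact: addr_ge0.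
rewrite E -ge0_fin_numE ?fin_numD ?nnsummable_fin//.
by apply: adde_ge0; apply: esum_ge0 => i _; rewrite lee_fin.
Qed.

Lemma nnsummable_le p q : (forall i, 0 <= p i <= q i) -> nnsummable q ->
  nnsummable p.
Proof.
move=> pq [q0 qs]; split=> [i|]; first by case/andP: (pq i).
apply: le_lt_trans qs; apply: le_esum => i _.
by rewrite lee_fin; case/andP: (pq i).
Qed.

Lemma nnsummableZ c p : 0 <= c -> nnsummable p ->
  nnsummable (fun i => c * p i) /\ nnsum (fun i => c * p i) = c * nnsum p.
Proof.
move=> c0 ps; have [p0 _] := ps.
have le a q : 0 <= a -> nnsummable q ->
    (\esum_(i in [set: I]) (a * q i)%:E <= a%:E * \esum_(i in [set: I]) (q i)%:E)%E.
  move=> a0 [q0 _]; apply: ge_ereal_sup => _ [F [Ffin FI] <-].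
  under eq_fsbigr do rewrite EFinM.
  rewrite -ge0_mule_fsumr; last by move=> i; rewrite lee_fin.
  apply: lee_wpmul2l; first by rewrite lee_fin.
  by apply: ereal_sup_ubound; exists F.
have cs : nnsummable (fun i => c * p i).
  split=> [i|]; first exact: mulr_ge0.
  apply: le_lt_trans (le _ _ c0 ps) _.
  by rewrite -ge0_fin_numE ?fin_numM ?nnsummable_fin// mule_ge0 ?esum_ge0// => i _;
    rewrite lee_fin.
split=> //.
have nnE q : nnsummable q ->
    (\esum_(i in [set: I]) (q i)%:E)%E = (nnsum q)%:E.
  by move=> qs; rewrite fineK// nnsummable_fin.
have [c00|cn0] := eqVneq c 0.
  rewrite c00 mul0r /nnsum esum1// => i _.
  by rewrite mul0r.
apply/eqP; rewrite eq_le; apply/andP; split.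
  by rewrite -lee_fin -nnE// EFinM -nnE// le.
rewrite -ler_pdivlMl ?lt_def ?cn0// -lee_fin EFinM -!nnE//.
apply: le_trans (le _ _ _ cs); last by rewrite invr_ge0.
by apply: le_esum => i _; rewrite mulKf.
Qed.

(** Taking positive parts is not additive, so linearity of [rsum] is derived from arbitrary
    decompositions. Two of them agree because [fp + q = fn + p] pointwise and [nnsum] is
    additive. *)
Lemma rsum_diff f p q : nnsummable p -> nnsummable q ->
  (forall i, f i = p i - q i) -> rsum f = nnsum p - nnsum q.
Proof.
move=> ps qs fE; have [p0 _] := ps; have [q0 _] := qs.
pose fp i := Num.max (f i) 0; pose fn i := Num.max (- f i) 0.
have fps : nnsummable fp.
  apply: nnsummable_le ps => i; rewrite /fp fE le_max lexx orbT/=.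
  by rewrite ge_max p0 andbT lerBlDr lerDl.
have fns : nnsummable fn.
  apply: nnsummable_le qs => i; rewrite /fn fE le_max lexx orbT/=.
  by rewrite ge_max q0 andbT opprB lerBlDr lerDl.
have -> : rsum f = nnsum fp - nnsum fn.
  rewrite /rsum /nnsum; congr (fine _ - fine _); apply: eq_esum => i _ /=.
    by rewrite funeposE /= EFin_max.
  by rewrite funenegE /= EFin_max.
have [_ E1] := nnsumD fps qs; have [_ E2] := nnsumD fns ps.
have : nnsum (fp \+ q) = nnsum (fn \+ p).
  congr nnsum; apply/funext => i /=; rewrite /fp /fn fE.
  by have := maxB0 (f i); rewrite !fE; lra.
by rewrite E1 E2 => H; lra.
Qed.

Definition rsummable f := nnsummable (fun i => `|f i|).

Lemma rsummable_split f : rsummable f -> exists p q,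
  [/\ nnsummable p, nnsummable q & forall i, f i = p i - q i].
Proof.
move=> fs; exists (fun i => Num.max (f i) 0), (fun i => Num.max (- f i) 0).
split.
- apply: nnsummable_le fs => i; rewrite le_max lexx orbT/=.
  by rewrite ge_max normr_ge0 ler_norm.
- apply: nnsummable_le fs => i; rewrite le_max lexx orbT/=.
  by rewrite ge_max normr_ge0 -normrN ler_norm.
- by move=> i; rewrite maxB0.
Qed.

Lemma rsumD f g : rsummable f -> rsummable g ->
  rsum (fun i => f i + g i) = rsum f + rsum g.
Proof.
move=> /rsummable_split[p [q [ps qs fE]]] /rsummable_split[p' [q' [p's q's gE]]].
have [pps pE] := nnsumD ps p's; have [qqs qE] := nnsumD qs q's.
rewrite (rsum_diff ps qs fE) (rsum_diff p's q's gE).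
rewrite (rsum_diff pps qqs) ?pE ?qE; first by lra.
by move=> i /=; rewrite fE gE; lra.
Qed.

Lemma rsumZ c f : rsummable f -> rsum (fun i => c * f i) = c * rsum f.
Proof.
move=> /rsummable_split[p [q [ps qs fE]]]; rewrite (rsum_diff ps qs fE).
have [c0|c0] := leP 0 c.
  have [ps' pE] := nnsummableZ c0 ps; have [qs' qE] := nnsummableZ c0 qs.
  rewrite (rsum_diff ps' qs') ?pE ?qE -?mulrBr// => i.
  by rewrite fE mulrBr.
have nc0 : 0 <= - c by rewrite oppr_ge0 ltW.
have [ps' pE] := nnsummableZ nc0 ps; have [qs' qE] := nnsummableZ nc0 qs.
rewrite (rsum_diff qs' ps') ?pE ?qE => [|i]; first by lra.
by rewrite fE; lra.
Qed.

Lemma rsummableZ c f : rsummable f -> rsummable (fun i => c * f i).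
Proof.
move=> fs; have [+ _] := nnsummableZ (normr_ge0 c) fs.
by apply: nnsummable_le => i; rewrite normr_ge0 normrM lexx.
Qed.

Lemma rsum_nonneg f : nnsummable f -> rsum f = nnsum f.
Proof.
move=> fs; have ? : nnsummable (fun=> 0).
  by split=> //; rewrite esum1 ?ltry.
rewrite (rsum_diff fs (q := fun=> 0))// => [|i]; last by rewrite subr0.
by rewrite [X in _ - X]/nnsum esum1//= subr0.
Qed.

Lemma rsum_reindex (phi : I -> I) f : bijective phi -> rsum (f \o phi) = rsum f.
Proof.
move=> bphi; rewrite /rsum; congr (fine _ - fine _);
  rewrite [RHS](@reindex_esum _ _ _ setT setT phi) ?setTT_bijective//;
  by apply: eq_esum => i _; rewrite ?funeposE ?funenegE.
Qed.

Lemma rsum_single (i : I) f : (forall j, j != i -> f j = 0) -> rsum f = f i.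
Proof.
move=> f0.
have E (F : \bar R -> \bar R) : F 0%E = 0%E -> (forall x, 0 <= F x)%E ->
    (\esum_(j in [set: I]) F (f j)%:E = F (f i)%:E)%E.
  move=> F0 Fge; rewrite -[RHS](@esum_set1 _ _ i (fun j => F (f j)%:E))//.
  rewrite [RHS]esum_mkcond; apply: eq_esum => j _.
  have [->|ji] := eqVneq j i; first by rewrite mem_set.
  by rewrite memNset ?f0//=; exact/eqP.
rewrite /rsum (eq_esum (b := fun j => maxe (f j)%:E 0%E)); last first.
  by move=> j _; rewrite funeposE.
rewrite [X in _ - fine X](eq_esum (b := fun j => maxe (- (f j)%:E)%E 0%E)); last first.
  by move=> j _; rewrite funenegE.
rewrite (E (maxe^~ 0%E)) ?(E (fun x => maxe (- x)%E 0%E)).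
- rewrite -EFinN -!EFin_max/=.
  exact: maxB0.
- by rewrite oppe0 maxxx.
- by move=> x; rewrite le_max lexx orbT.
- by rewrite maxxx.
- by move=> x; rewrite le_max lexx orbT.
Qed.

End RealSums.

Section InnerProduct.
Variables (R : realType) (I : choiceType).
Import ComplexField.Normc.
Local Open Scope complex_scope.
Implicit Types (F G : I -> R[i]) (xi eta zeta : ell2 R I).

Definition csummable F :=
  rsummable (fun i => complex.Re (F i)) /\ rsummable (fun i => complex.Im (F i)).

Lemma csumD F G : csummable F -> csummable G ->
  csum (fun i => F i + G i) = csum F + csum G.
Proof.
move=> [Fr Fi] [Gr Gi]; rewrite /csum.
under eq_fun do rewrite raddfD.
rewrite rsumD//; under [X in _ +i* rsum X]eq_fun do rewrite raddfD.
by rewrite rsumD.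
Qed.

Lemma csumZ c F : csummable F -> csum (fun i => c * F i) = c * csum F.
Proof.
case: c => a b [Fr Fi]; rewrite /csum.
rewrite (_ : (fun i => complex.Re _) =
    (fun i => a * complex.Re (F i) + (- b) * complex.Im (F i))); last first.
  by apply/funext => i; case: (F i) => x y /=; rewrite mulNr.
rewrite (_ : (fun i => complex.Im _) =
    (fun i => a * complex.Im (F i) + b * complex.Re (F i))); last first.
  by apply/funext => i; case: (F i) => x y /=.
rewrite !rsumD ?rsumZ; try exact: rsummableZ; try by [].
by simpc; congr (_ +i* _); rewrite // mulNr.
Qed.

Lemma csumC F : csummable F -> csum (fun i => conjc (F i)) = conjc (csum F).
Proof.
move=> [Fr Fi]; rewrite /csum/=; congr (_ +i* _).
  by congr rsum; apply/funext => i; case: (F i).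
rewrite -mulN1r -rsumZ//; congr rsum; apply/funext => i.
by rewrite mulN1r; case: (F i).
Qed.

Lemma csum_single i F : (forall j, j != i -> F j = 0) -> csum F = F i.
Proof.
move=> F0; rewrite /csum (rsum_single (i := i)) => [|j ji]; last by rewrite F0.
rewrite (rsum_single (i := i)) => [|j ji]; last by rewrite F0.
by case: (F i).
Qed.

Lemma csum_reindex (phi : I -> I) F : bijective phi -> csum (F \o phi) = csum F.
Proof.
move=> bphi; rewrite /csum.
by congr (_ +i* _); rewrite -[RHS](rsum_reindex _ bphi).
Qed.

Lemma normc_ge0 (z : R[i]) : 0 <= normc z.
Proof. by case: z => a b; exact: sqrtr_ge0. Qed.

Lemma normc_sqr (z : R[i]) :
  normc z ^+ 2 = complex.Re z ^+ 2 + complex.Im z ^+ 2.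
Proof. by case: z => a b /=; rewrite sqr_sqrtr// addr_ge0 ?sqr_ge0. Qed.

Lemma normc_mulC (z : R[i]) : z * conjc z = (normc z ^+ 2)%:C.
Proof.
rewrite normc_sqr; case: z => a b /=; simpc; congr (_ +i* _).
by rewrite mulrC addrC subrr.
Qed.

Lemma Re_le_normc (z : R[i]) : `|complex.Re z| <= normc z.
Proof.
by rewrite -[leRHS]ger0_norm ?normc_ge0// -ler_sqr ?nnegrE// !real_normK ?num_real//
  normc_sqr lerDl sqr_ge0.
Qed.

Lemma Im_le_normc (z : R[i]) : `|complex.Im z| <= normc z.
Proof.
by rewrite -[leRHS]ger0_norm ?normc_ge0// -ler_sqr ?nnegrE// !real_normK ?num_real//
  normc_sqr lerDr sqr_ge0.
Qed.

Lemma normc_conj (z : R[i]) : normc (conjc z) = normc z.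
Proof. by case: z => a b /=; rewrite sqrrN. Qed.

Lemma ell2_nnsummable xi : nnsummable (fun i => normc (xi i) ^+ 2).
Proof.
case: xi => f /= /asboolP fs; split=> // i; exact: sqr_ge0.
Qed.

Lemma inner_csummable xi eta : csummable (fun i => xi i * conjc (eta i)).
Proof.
have [+ _] := nnsumD (ell2_nnsummable xi) (ell2_nnsummable eta) => S.
have le (z w : R[i]) : normc (z * conjc w) <= normc z ^+ 2 + normc w ^+ 2.
  rewrite normcM normc_conj.
  by have := normc_ge0 z; have := normc_ge0 w; nra.
split; apply: nnsummable_le S => i; rewrite normr_ge0/=.
  exact: le_trans (Re_le_normc _) (le _ _).
exact: le_trans (Im_le_normc _) (le _ _).
Qed.

Lemma ell2P xi eta : (forall i, xi i = eta i) -> xi = eta.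
Proof. by move=> E; apply: val_inj; apply/funext. Qed.

Lemma ell2_addE xi eta i : (xi + eta) i = xi i + eta i. Proof. by []. Qed.
Lemma ell2_scaleE (a : R[i]) xi i : (a *: xi) i = a * xi i. Proof. by []. Qed.
Lemma ell2_oppE xi i : (- xi) i = - xi i. Proof. by []. Qed.

Lemma ell2_sumE (T : Type) (r : seq T) (P : pred T) (f : T -> ell2 R I) i :
  (\sum_(t <- r | P t) f t) i = \sum_(t <- r | P t) f t i.
Proof. by elim/big_ind2: _ => // u v x y <- <-. Qed.

Lemma innerDl xi eta zeta : inner (xi + eta) zeta = inner xi zeta + inner eta zeta.
Proof.
rewrite /inner -csumD; do ?exact: inner_csummable.
by congr csum; apply/funext => i; rewrite -mulrDl.
Qed.

Lemma innerZl a xi zeta : inner (a *: xi) zeta = a * inner xi zeta.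
Proof.
rewrite /inner -csumZ; last exact: inner_csummable.
by congr csum; apply/funext => i; rewrite mulrA.
Qed.

Lemma innerC xi eta : inner eta xi = conjc (inner xi eta).
Proof.
rewrite /inner -csumC; last exact: inner_csummable.
by congr csum; apply/funext => i; rewrite rmorphM/= conjcK mulrC.
Qed.

Lemma innerDr xi eta zeta : inner zeta (xi + eta) = inner zeta xi + inner zeta eta.
Proof.
rewrite innerC innerDl [inner zeta xi]innerC [inner zeta eta]innerC.
exact: rmorphD.
Qed.

Lemma innerZr a xi zeta : inner zeta (a *: xi) = conjc a * inner zeta xi.
Proof. by rewrite innerC innerZl [inner zeta xi]innerC; exact: rmorphM. Qed.

Lemma inner0l xi : inner 0 xi = 0.
Proof. by rewrite -(scale0r xi) innerZl mul0r. Qed.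

Lemma inner0r xi : inner xi 0 = 0.
Proof. by rewrite innerC inner0l rmorph0. Qed.

Lemma inner_suml (T : Type) (r : seq T) (f : T -> ell2 R I) xi :
  inner (\sum_(t <- r) f t) xi = \sum_(t <- r) inner (f t) xi.
Proof.
elim: r => [|t r IH]; first by rewrite !big_nil inner0l.
by rewrite !big_cons innerDl IH.
Qed.

Lemma inner_sumr (T : Type) (r : seq T) (f : T -> ell2 R I) xi :
  inner xi (\sum_(t <- r) f t) = \sum_(t <- r) inner xi (f t).
Proof.
elim: r => [|t r IH]; first by rewrite !big_nil inner0r.
by rewrite !big_cons innerDr IH.
Qed.

Lemma inner_delta xi i : inner xi (delta R i) = xi i.
Proof.
rewrite /inner (csum_single (i := i)) => [|j ji] /=.
  by rewrite eqxx rmorph1 mulr1.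
by rewrite (negPf ji) rmorph0 mulr0.
Qed.

Definition normsq xi : R := complex.Re (inner xi xi).

Lemma normsqE xi : normsq xi = nnsum (fun i => normc (xi i) ^+ 2).
Proof.
rewrite /normsq /inner /csum /= -rsum_nonneg; last exact: ell2_nnsummable.
by congr rsum; apply/funext => i; rewrite normc_mulC.
Qed.

Lemma normsq_ge0 xi : 0 <= normsq xi.
Proof. by rewrite normsqE nnsum_ge0//; exact: ell2_nnsummable. Qed.

Lemma ell2_norm_sqrt xi : ell2_norm xi = Num.sqrt (normsq xi).
Proof. by []. Qed.

(** By the parallelogram identity the slack is the squared norm of [xi - eta]. This plays the part
    of the triangle inequality for squared norms. *)
Lemma normsqD xi eta : normsq (xi + eta) <= 2 * normsq xi + 2 * normsq eta.
Proof.
have := normsq_ge0 (xi + (- 1) *: eta).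
rewrite /normsq !(innerDl, innerDr, innerZl, innerZr) !raddfD/=.
case: (inner xi xi) (inner xi eta) (inner eta xi) (inner eta eta)
  => [a b] [c d] [e f] [g h] /=.
by lra.
Qed.

Lemma normsqZ a xi : normsq (a *: xi) = normc a ^+ 2 * normsq xi.
Proof.
rewrite /normsq innerZl innerZr mulrA normc_mulC.
by case: (inner _ _) => u v /=; rewrite mul0r subr0.
Qed.

Lemma normsq0 : normsq 0 = 0.
Proof. by rewrite /normsq inner0l. Qed.

(** Iterates [normsqD]. The exponential factor is harmless where this is applied, as the number of
    terms is fixed before the precision is chosen. *)
Lemma normsq_sum (T : Type) (r : seq T) (f : T -> ell2 R I) :
  normsq (\sum_(t <- r) f t) <= 2 ^+ size r * \sum_(t <- r) normsq (f t).
Proof.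
elim: r => [|t r IH]; first by rewrite !big_nil normsq0 mulr0.
rewrite !big_cons exprS -mulrA mulrDr.
apply: le_trans (normsqD _ _) _; rewrite -[leLHS]mulrDr ler_pM2l// lerD//.
rewrite -[leLHS]mul1r ler_wpM2r ?normsq_ge0// exprn_ege1// ler1n//.
Qed.

Lemma finite_support_approx xi (eps : R) : 0 < eps -> exists r : seq I,
  normsq (xi - \sum_(i <- r) xi i *: delta R i) < eps.
Proof.
move=> e0; pose p i := normc (xi i) ^+ 2.
have ps : nnsummable p := ell2_nnsummable xi.
have pE : (\esum_(i in [set: I]) (p i)%:E)%E = (nnsum p)%:E.
  by rewrite fineK// nnsummable_fin.
have [|_ [S [/finite_seqP[r0 SE] _] <-]] := @ub_ereal_sup_adherent _
    [set (\sum_(x \in A) (p x)%:E)%E | A in fsets [set: I]] eps e0.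
  by rewrite (_ : ereal_sup _ = (nnsum p)%:E).
rewrite [ereal_sup _]pE -EFinB => Slt.
(* Without repetitions the combination of the [delta R i] is exactly the restriction of [xi] to [r],
   and the difference is the tail [q]. *)
exists (undup r0); set r := undup r0.
pose q i := if i \in r then 0 else p i.
pose q' i := if i \in r then p i else 0.
have p0 i : 0 <= p i by exact: sqr_ge0.
have qs : nnsummable q.
  by apply: nnsummable_le ps => i; rewrite /q; case: ifP; rewrite ?lexx p0.
have q's : nnsummable q'.
  by apply: nnsummable_le ps => i; rewrite /q'; case: ifP; rewrite ?lexx p0.
have pqq' : p = q \+ q'.
  by apply/funext => i; rewrite /q /q' /=; case: ifP; rewrite ?add0r ?addr0.
have [_ pS] := nnsumD qs q's; rewrite -pqq' in pS.
rewrite normsqE (_ : (fun _ => _) = q); last first.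
  apply/funext => i; rewrite ell2_addE ell2_oppE ell2_sumE /q /p.
  under eq_bigr do rewrite ell2_scaleE.
  have [ir|ir] := boolP (i \in r).
    rewrite (big_rem i)//= eqxx mulr1 big_seq big1 ?addr0 ?subrr ?normc0 ?expr0n//.
    move=> j; have [->|ji _] := eqVneq i j; last by rewrite mulr0.
    by rewrite mem_rem_uniqF// undup_uniq.
  rewrite big_seq big1 ?subr0// => j jr.
  have [ij|ij] := eqVneq i j; first by rewrite ij jr in ir.
  by rewrite /= (negPf ij) mulr0.
have : ((nnsum p - eps)%:E < (nnsum q')%:E)%E.
  apply: lt_le_trans Slt _.
  rewrite /nnsum fineK ?nnsummable_fin//.
  apply: ereal_sup_ubound; exists S; first by split=> //; rewrite SE; apply/finite_seqP; exists r0.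
  apply: eq_fsbigr => i /set_mem; rewrite SE /= /q' mem_undup => ->//.
by rewrite lte_fin pS; lra.
Qed.

End InnerProduct.

(** * Regular representations and the Walsh unitaries *)

Section SymmetricDifference.
Variable J : finType.
Implicit Types b d : {set J}.

(** The group law of the elementary abelian 2-group of subsets of [J]. A family of commuting
    involutions indexed by [J] is treated as a homomorphism from this group. *)
Definition symd b d : {set J} := [set j | (j \in b) (+) (j \in d)]%SET.

Lemma in_symd b d j : (j \in symd b d) = (j \in b) (+) (j \in d).
Proof. by rewrite inE. Qed.

Lemma symdK b : involutive (symd b).
Proof. by move=> d; apply/setP => j; rewrite !in_symd addKb. Qed.

Lemma symdC b d : symd b d = symd d b.
Proof. by apply/setP => j; rewrite !in_symd addbC. Qed.

Lemma symd0 b : symd b finset.set0 = b.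
Proof. by apply/setP => j; rewrite in_symd inE addbF. Qed.

Lemma symdd b : symd b b = finset.set0.
Proof. by apply/setP => j; rewrite in_symd inE addbb. Qed.

End SymmetricDifference.

Section RegularOperators.
Variables (R : realType) (G : groupType).
Local Open Scope complex_scope.
Implicit Types (xi eta : ell2 R G) (g h : G).

Lemma right_regular_subproof h xi :
  (fun x => xi (x * h)%g) \in @ell2_pred R G.
Proof.
case: xi => f /= /asboolP fS; apply/asboolP.
rewrite /square_summable in fS *.
rewrite (@reindex_esum _ _ _ setT setT (fun x => x * h^-1)%g)//.
- by under eq_esum do rewrite mulgVK.
- split=> // [x y _ _ /mulIg//|y _].
  by exists (y * h)%g; rewrite ?mulgK.
Qed.

Definition right_regular h xi : ell2 R G := Ell2 (right_regular_subproof h xi).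

Lemma left_regular_linear h : linear (@left_regular R G h).
Proof. by move=> a x y; apply: ell2P. Qed.

Lemma right_regular_linear h : linear (right_regular h).
Proof. by move=> a x y; apply: ell2P. Qed.

Lemma left_right_regular g h xi :
  left_regular g (right_regular h xi) = right_regular h (left_regular g xi).
Proof. by apply: ell2P => x /=; rewrite mulgA. Qed.

Lemma left_regular_delta g h : left_regular g (delta R h) = delta R (g * h)%g.
Proof.
apply: ell2P => x /=; congr (_%:R); congr nat_of_bool.
by apply/eqP/eqP => [<-|->]; rewrite ?mulVKg ?mulKg.
Qed.

Lemma right_regular_delta g h :
  right_regular g (delta R h) = delta R (h * g^-1)%g.
Proof.
apply: ell2P => x /=; congr (_%:R); congr nat_of_bool.
by apply/eqP/eqP => [<-|->]; rewrite ?mulgK ?mulgVK.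
Qed.

Lemma left_regular_inner h xi eta :
  inner (left_regular h xi) eta = inner xi (left_regular h^-1 eta).
Proof.
have bh : bijective (fun x => h * x)%g.
  by exists (fun x => h^-1 * x)%g => x; rewrite ?mulKg ?mulVKg.
rewrite /inner -[LHS](csum_reindex _ bh); congr csum; apply/funext => x /=.
by rewrite mulKg invgK.
Qed.

Lemma right_regular_inner h xi eta :
  inner (right_regular h xi) eta = inner xi (right_regular h^-1 eta).
Proof.
have bh : bijective (fun x => x * h)%g.
  by exists (fun x => x * h^-1)%g => x; rewrite ?mulgK ?mulgVK.
rewrite /inner -[RHS](csum_reindex _ bh); congr csum; apply/funext => x /=.
by rewrite mulgK.
Qed.

Lemma normsq_right_regular h xi : normsq (right_regular h xi) = normsq xi.
Proof.
rewrite /normsq right_regular_inner; congr (complex.Re (inner _ _)).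
by apply: ell2P => x /=; rewrite mulgVK.
Qed.

Lemma bounded_normsq (T : ell2 R G -> ell2 R G) :
  linear T -> (forall xi, normsq (T xi) = normsq xi) -> bounded_operator T.
Proof.
by move=> Tl Tn; split=> //; exists 1 => xi; rewrite mul1r !ell2_norm_sqrt Tn.
Qed.

Lemma right_regular_commutant h :
  commutant (range (@left_regular R G)) (right_regular h).
Proof.
split; first exact: bounded_normsq (right_regular_linear h) (normsq_right_regular h).
by move=> _ [g _ <-]; apply/funext => xi /=; rewrite left_right_regular.
Qed.

Lemma group_vN_right_regular a h xi : group_vN a ->
  a (right_regular h xi) = right_regular h (a xi).
Proof.
by move=> [_ /(_ _ (right_regular_commutant h)) E]; exact: (congr1 (@^~ xi) E).
Qed.

Lemma adjoint_unique (T S : ell2 R G -> ell2 R G) : is_adjoint T S -> adjoint T = S.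
Proof.
move=> TS; have [_ TS'] := TS; rewrite /adjoint.
case: xgetP => [S' _ [_ S'E]|/(_ S)//].
apply/funext => eta; apply: ell2P => i.
by rewrite -!inner_delta innerC -S'E TS' -innerC.
Qed.

(* When [T] has no adjoint the junk value of [adjoint T] is zero. *)
Lemma two_norm_le (T : ell2 R G -> ell2 R G) :
  two_norm (@group_trace R G) T <= Num.sqrt (normsq (T (delta R 1%g))).
Proof.
rewrite /two_norm /group_trace /adjoint.
case: xgetP => [S _ [_ SE]|_]; last first.
  rewrite (_ : inner _ _ = 0) ?sqrtr0 ?sqrtr_ge0//; exact: inner0l.
apply: ler_wsqrtr.
set v := delta R 1%g.
have -> : inner ((S \o T) v) v = conjc (inner (T v) (T v)) by rewrite SE innerC.
by rewrite /normsq; case: (inner _ _).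
Qed.

Section WalshUnitary.
Variables (J : finType) (h : {set J} -> G) (c : {set J} -> R).
Hypothesis hM : {morph h : b d / symd b d >-> (b * d)%g}.
Hypothesis h_inj : injective h.
Hypothesis c_conv : forall d,
  \sum_b c b * c (symd b d) = (d == finset.set0)%:R.

(** The group algebra element with coefficient [c b] at [h b], acting from the left and from the
    right. It is self-adjoint because [c] is real and each [h b] is its own inverse; it squares to 1
    because [c_conv] makes [c] its own inverse under convolution. *)
Definition walsh_left xi : ell2 R G := \sum_b (c b)%:C *: left_regular (h b) xi.
Definition walsh_right xi : ell2 R G :=
  \sum_b (c b)%:C *: right_regular (h b) xi.

Lemma walsh_hom1 : h finset.set0 = 1%g.
Proof.
have := hM finset.set0 finset.set0; rewrite symdd => /esym E.
by apply: (mulgI (h finset.set0)); rewrite E mulg1.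
Qed.

Lemma walsh_homV b : (h b)^-1%g = h b.
Proof.
by apply: (mulgI (h b)); rewrite mulgV -hM symdd walsh_hom1.
Qed.

Lemma walsh_left_linear : linear walsh_left.
Proof.
move=> a x y; rewrite /walsh_left scaler_sumr -big_split; apply: eq_bigr => b _ /=.
by rewrite left_regular_linear scalerDr !scalerA mulrC.
Qed.

Lemma walsh_right_linear : linear walsh_right.
Proof.
move=> a x y; rewrite /walsh_right scaler_sumr -big_split; apply: eq_bigr => b _ /=.
by rewrite right_regular_linear scalerDr !scalerA mulrC.
Qed.

Lemma walsh_left_adj xi eta : inner (walsh_left xi) eta = inner xi (walsh_left eta).
Proof.
rewrite /walsh_left inner_suml inner_sumr; apply: eq_bigr => b _.
by rewrite innerZl innerZr left_regular_inner walsh_homV /= oppr0.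
Qed.

Lemma walsh_right_adj xi eta :
  inner (walsh_right xi) eta = inner xi (walsh_right eta).
Proof.
rewrite /walsh_right inner_suml inner_sumr; apply: eq_bigr => b _.
by rewrite innerZl innerZr right_regular_inner walsh_homV /= oppr0.
Qed.

Lemma walsh_conv_sum (f : {set J} -> ell2 R G) :
  \sum_b \sum_d (c b * c d)%:C *: f (symd b d) = f finset.set0.
Proof.
transitivity (\sum_b \sum_e (c b * c (symd b e))%:C *: f e).
  apply: eq_bigr => b _; rewrite (reindex_inj (inv_inj (symdK b))).
  by apply: eq_bigr => e _; rewrite symdK.
rewrite exchange_big/= (bigD1 finset.set0)//= [X in _ + X]big1 ?addr0.
  rewrite -scaler_suml -(rmorph_sum (real_complex R)) c_conv eqxx.
  by rewrite rmorph1 scale1r.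
move=> e e0; rewrite -scaler_suml -(rmorph_sum (real_complex R)) c_conv (negPf e0).
by rewrite rmorph0 scale0r.
Qed.

Lemma walsh_leftK : involutive walsh_left.
Proof.
move=> xi; rewrite -[RHS](_ : left_regular (h finset.set0) xi = _); last first.
  by apply: ell2P => x /=; rewrite walsh_hom1 invg1 mul1g.
rewrite -(walsh_conv_sum (fun b => left_regular (h b) xi)).
apply: eq_bigr => b _; apply: ell2P => x.
rewrite ell2_scaleE /= ell2_sumE mulr_sumr ell2_sumE; apply: eq_bigr => d _.
rewrite !ell2_scaleE /= mulrA -rmorphM /=; congr (_ * xi _).
by rewrite hM invMg !mulgA.
Qed.

Lemma walsh_rightK : involutive walsh_right.
Proof.
move=> xi; rewrite -[RHS](_ : right_regular (h finset.set0) xi = _); last first.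
  by apply: ell2P => x /=; rewrite walsh_hom1 mulg1.
rewrite -(walsh_conv_sum (fun b => right_regular (h b) xi)).
apply: eq_bigr => b _; apply: ell2P => x.
rewrite ell2_scaleE /= ell2_sumE mulr_sumr ell2_sumE; apply: eq_bigr => d _.
rewrite !ell2_scaleE /= mulrA -rmorphM /=; congr (_ * xi _).
by rewrite hM !mulgA.
Qed.

Lemma normsq_walsh_left xi : normsq (walsh_left xi) = normsq xi.
Proof. by rewrite /normsq walsh_left_adj walsh_leftK. Qed.

Lemma normsq_walsh_right xi : normsq (walsh_right xi) = normsq xi.
Proof. by rewrite /normsq walsh_right_adj walsh_rightK. Qed.

Lemma linear_sum_op (T : ell2 R G -> ell2 R G) (A : Type) (r : seq A)
  (k : A -> R[i]) (v : A -> ell2 R G) : linear T ->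
  T (\sum_(x <- r) k x *: v x) = \sum_(x <- r) k x *: T (v x).
Proof.
move=> Tl; elim: r => [|x r IH]; last by rewrite !big_cons Tl IH.
rewrite !big_nil; have := Tl (- 1) 0 0.
by rewrite scaler0 addr0 scaleN1r addNr.
Qed.

Lemma walsh_left_unitary : unitary_operator walsh_left.
Proof.
have bU := bounded_normsq walsh_left_linear normsq_walsh_left.
have -> : unitary_operator walsh_left <->
    [/\ bounded_operator walsh_left, walsh_left \o walsh_left = id
      & walsh_left \o walsh_left = id].
  rewrite /unitary_operator (@adjoint_unique walsh_left walsh_left)//.
  by split=> //; exact: walsh_left_adj.
by split=> //; apply/funext => xi /=; rewrite walsh_leftK.
Qed.

Lemma walsh_left_vN : group_vN walsh_left.
Proof.
split; first exact: bounded_normsq walsh_left_linear normsq_walsh_left.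
move=> T [[Tl _] TL]; apply/funext => xi /=.
rewrite /walsh_left linear_sum_op//; apply: eq_bigr => b _; congr (_ *: _).
have /(TL _) E : range (@left_regular R G) (left_regular (h b)) by exists (h b).
by have := congr1 (@^~ xi) E.
Qed.

Lemma walsh_left_delta g :
  walsh_left (delta R g) = \sum_b (c b)%:C *: delta R (h b * g)%g.
Proof. by apply: eq_bigr => b _; rewrite left_regular_delta. Qed.

Lemma walsh_right_delta g :
  walsh_right (delta R g) = \sum_b (c b)%:C *: delta R (g * h b)%g.
Proof. by apply: eq_bigr => b _; rewrite right_regular_delta walsh_homV. Qed.

Lemma group_trace_walsh_left : c finset.set0 = 0 -> group_trace walsh_left = 0.
Proof.
move=> c0; rewrite /group_trace inner_delta walsh_left_delta ell2_sumE big1// => b _.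
rewrite ell2_scaleE /= mulg1; have [->|b0] := eqVneq b finset.set0.
  by rewrite c0 rmorph0 mul0r.
case: eqP => [/esym E|_]; last by rewrite mulr0.
by move: b0; rewrite -(inj_eq h_inj) E walsh_hom1 eqxx.
Qed.

(* On [delta 1] the left and right versions agree, and [a] commutes with the
   right one. *)
Lemma walsh_commutator a : group_vN a ->
  op_commutator a walsh_left (delta R 1%g) =
  walsh_right (a (delta R 1%g)) - walsh_left (a (delta R 1%g)).
Proof.
move=> aM; have [[al _] _] := aM.
rewrite /op_commutator /=; congr (_ - _).
rewrite walsh_left_delta.
under eq_bigr do rewrite mulg1 -[h _]mul1g.
rewrite -walsh_right_delta /walsh_right linear_sum_op//.
by apply: eq_bigr => b _; rewrite group_vN_right_regular.
Qed.

Lemma normsq_walsh_diff xi :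
  normsq (walsh_right xi - walsh_left xi) <= 4 * normsq xi.
Proof.
apply: le_trans (normsqD _ _) _.
rewrite -scaleN1r normsqZ normsq_walsh_left normsq_walsh_right.
rewrite normcN ComplexField.Normc.normc1 expr1n mul1r.
by rewrite -mulrDl -natrD.
Qed.

Lemma normsq_delta_comb (k : {set J} -> R) g :
  normsq (\sum_b (k b)%:C *: delta R (h b * g)%g) = \sum_b k b ^+ 2.
Proof.
rewrite /normsq inner_suml raddf_sum; apply: eq_bigr => b _.
rewrite innerZl innerC inner_delta ell2_sumE (bigD1 b)// ell2_scaleE.
rewrite big1 ?addr0 => [|d db].
  by rewrite /= eqxx /= !(mulr1, mulr0, subr0, oppr0, mul0r, addr0).
rewrite ell2_scaleE /=; case: eqP => [/mulIg /h_inj E|_]; last by rewrite mulr0.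
by rewrite E eqxx in db.
Qed.

(** The hypothesis says that moving [g] across the element turns the coefficients [c] into [k]. The
    vectors [delta R (h b * g)] are orthonormal, so the defect is the distance of the two
    coefficient families. *)
Lemma normsq_walsh_diff_delta g (k : {set J} -> R) :
  \sum_b (c b)%:C *: delta R (g * h b)%g = \sum_b (k b)%:C *: delta R (h b * g)%g ->
  normsq (walsh_right (delta R g) - walsh_left (delta R g)) =
  \sum_b (k b - c b) ^+ 2.
Proof.
move=> E; rewrite walsh_right_delta walsh_left_delta E -sumrB.
rewrite -(normsq_delta_comb _ g); congr normsq; apply: eq_bigr => b _.
by rewrite -scalerBl rmorphB.
Qed.

End WalshUnitary.

End RegularOperators.

(** * Reduction to approximate commutation with finitely many group elements *)

Section PropertyGammaCriterion.
Variables (R : realType) (G : groupType).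
Local Open Scope complex_scope.

(** All that the operator argument asks of the group. The right version minus the left one at
    [delta R g] measures how far the group algebra element is from commuting with [g]. *)
Definition walsh_central (E : seq G) (eps : R) : Prop :=
  exists (J : finType) (h : {set J} -> G) (c : {set J} -> R),
  [/\ {morph h : b d / symd b d >-> (b * d)%g}, injective h,
      forall d, \sum_b c b * c (symd b d) = (d == finset.set0)%:R,
      c finset.set0 = 0
    & forall g, g \in E ->
      normsq (walsh_right h c (delta R g) - walsh_left h c (delta R g)) < eps].

Lemma factor_property_Gamma_of_walsh :
  (forall (E : seq G) (eps : R), 0 < eps -> walsh_central E eps) ->
  factor_property_Gamma (@group_vN R G) (@group_trace R G).
Proof.
move=> W eps Omega e0 Ofin OM.
pose v (a : ell2 R G -> ell2 R G) := a (delta R 1%g).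
(* The truncation error is multiplied by at most 4 in [normsq_walsh_diff] and by 2 in [normsqD],
   which uses up half of [eps ^+ 2]. *)
have e20 : 0 < eps ^+ 2 / 16 by rewrite divr_gt0 ?exprn_gt0.
have [r rP] := @choice _ _
  (fun a r => normsq (v a - \sum_(i <- r) v a i *: delta R i) < eps ^+ 2 / 16)
  (fun a => finite_support_approx (v a) e20).
have /finite_seqP[s Os] := Ofin.
(* [A a] is the loss of [normsq_sum] on the truncation of [v a]. [S] dominates it for all [a] in
   [Omega], so the precision can be fixed before the unitary is chosen. *)
pose A a := 2 ^+ size (r a) *
  \sum_(i <- r a) ComplexField.Normc.normc (v a i) ^+ 2.
have A0 a : 0 <= A a.
  by rewrite mulr_ge0 ?exprn_ge0// sumr_ge0// => i _; rewrite sqr_ge0.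
pose S := 1 + \sum_(a <- s) A a.
have S0 : 0 < S by rewrite ltr_pwDl// sumr_ge0.
have eta0 : 0 < eps ^+ 2 / (8 * S) by rewrite divr_gt0 ?exprn_gt0// mulr_gt0.
have [J [h [c [hM hI cc c0 cE]]]] := W (flatten [seq r a | a <- s]) _ eta0.
exists (walsh_left h c); split.
- exact: walsh_left_vN.
- exact: walsh_left_unitary.
- exact: group_trace_walsh_left.
move=> a aO; have aM := OM _ aO.
have as_ : a \in s by move: aO; rewrite Os.
apply: le_lt_trans (two_norm_le _) _.
rewrite -[ltRHS]gtr0_norm// -sqrtr_sqr ltr_sqrt ?exprn_gt0//.
rewrite walsh_commutator// -/(v a).
pose D xi := walsh_right h c xi - walsh_left h c xi.
have Dl : linear D.
  move=> k x y; rewrite /D walsh_right_linear walsh_left_linear.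
  by rewrite scalerBr opprD addrACA.
pose w := \sum_(i <- r a) v a i *: delta R i.
have -> : walsh_right h c (v a) - walsh_left h c (v a) = D w + D (v a - w).
  rewrite -[LHS]/(D (v a)) -{1}[v a](subrK w) addrC.
  by have := Dl 1 w (v a - w); rewrite !scale1r.
apply: le_lt_trans (normsqD _ _) _.
have h1 : normsq (D (v a - w)) < eps ^+ 2 / 4.
  apply: le_lt_trans (normsq_walsh_diff hM cc _) _.
  by have := rP a; rewrite -/w; lra.
have h2 : normsq (D w) <= eps ^+ 2 / 8.
  rewrite /w linear_sum_op//.
  apply: le_trans (normsq_sum _ _) _.
  apply: (@le_trans _ _ (A a * (eps ^+ 2 / (8 * S)))).
    rewrite /A -mulrA ler_wpM2l ?exprn_ge0// mulr_suml big_seq [leRHS]big_seq.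
    apply: ler_sum => i ir; rewrite normsqZ ler_wpM2l ?sqr_ge0//.
    by apply/ltW/cE/flattenP; exists (r a) => //; apply: map_f.
  rewrite mulrA ler_pdivrMr ?mulr_gt0//.
  have : A a <= S.
    rewrite /S (big_rem a)//= addrCA lerDl addr_ge0// sumr_ge0//.
  rewrite mulrC (_ : eps ^+ 2 / 8 * (8 * S) = eps ^+ 2 * S); last by field.
  by move=> ?; rewrite ler_wpM2l// sqr_ge0.
lra.
Qed.

End PropertyGammaCriterion.

(** * Walsh functions and noise stability of the majority function *)

Section WalshFunctions.
Variables (R : realType) (J : finType).
Implicit Types (b d x y F : {set J}) (f g : {set J} -> R).

Local Notation N := (#|{set J}|%:R : R).

Lemma cube_card_gt0 : 0 < N.
Proof. by rewrite ltr0n; apply/card_gt0P; exists finset.set0. Qed.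

Definition walsh b x : R := (-1) ^+ #|b :&: x|%SET.

Lemma walshE b x : walsh b x = \prod_j (if (j \in b) && (j \in x) then -1 else 1).
Proof.
rewrite /walsh -prodr_const big_mkcond; apply: eq_bigr => j _.
by rewrite inE.
Qed.

Lemma walshC b x : walsh b x = walsh x b.
Proof. by rewrite /walsh finset.setIC. Qed.

Lemma walshM b d x : walsh b x * walsh d x = walsh (symd b d) x.
Proof.
rewrite !walshE -big_split; apply: eq_bigr => j _ /=.
by rewrite in_symd; case: (j \in b); case: (j \in d); case: (j \in x);
  rewrite /= ?mulrNN ?mulr1 ?mul1r.
Qed.

Lemma sum_walsh b : \sum_x walsh b x = N * (b == finset.set0)%:R.
Proof.
have [->|[j jb]] := finset.set_0Vmem b.
  rewrite eqxx mulr1 -sum1_card natr_sum; apply: eq_bigr => x _.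
  by rewrite /walsh finset.set0I cards0.
have -> : (b == finset.set0) = false.
  by apply/eqP => b0; rewrite b0 inE in jb.
rewrite mulr0; set S := \sum_x _; suff : S = - S by lra.
rewrite {1}/S (reindex_inj (inv_inj (symdK [set j]%SET))) -sumrN.
apply: eq_bigr => x _; rewrite walshC -walshM ![walsh _ b]walshC.
suff -> : walsh b [set j]%SET = -1 by rewrite mulN1r.
rewrite /walsh (_ : (b :&: [set j])%SET = [set j]%SET) ?cards1//.
by apply/finset.setIidPr; rewrite finset.sub1set.
Qed.

Definition wcoef f b : R := N^-1 * \sum_x f x * walsh b x.

(** The convolution theorem: orthogonality of the characters removes the terms with [x] different
    from [y]. For equal sign-valued functions it yields the identity behind unitarity, and at the
    empty set Parseval's formula. *)
Lemma wcoef_conv f g d : \sum_b wcoef f b * wcoef g (symd b d) =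
  N^-1 * \sum_x f x * g x * walsh d x.
Proof.
have N0 : N != 0 by rewrite gt_eqF ?cube_card_gt0.
transitivity (\sum_b N^-1 * (N^-1 * \sum_x \sum_y
    f x * g y * walsh d y * (walsh b x * walsh b y))).
  apply: eq_bigr => b _; rewrite /wcoef mulrACA -mulrA; congr (_ * (_ * _)).
  rewrite mulr_suml; apply: eq_bigr => x _; rewrite mulr_sumr.
  by apply: eq_bigr => y _; rewrite -walshM; ring.
rewrite -mulr_sumr. congr (_ * _). rewrite -[LHS]mulr_sumr exchange_big mulr_sumr.
apply: eq_bigr => x _; rewrite exchange_big (bigD1 x)//= [X in _ + X]big1 ?addr0 => [|y yx].
  rewrite -mulr_sumr; under eq_bigr do rewrite ![walsh _ x]walshC walshM symdd.
  rewrite sum_walsh eqxx mulr1 mulrC mulfK//.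
rewrite -mulr_sumr; under eq_bigr do rewrite ![walsh _ x]walshC ![walsh _ y]walshC walshM.
rewrite sum_walsh (_ : (symd x y == _) = false) ?mulr0//.
apply/eqP => E; move/eqP: yx; apply.
by rewrite -(symd0 x) -E symdK.
Qed.

Lemma wcoef_conv_sign f : (forall x, f x ^+ 2 = 1) ->
  forall d, \sum_b wcoef f b * wcoef f (symd b d) = (d == finset.set0)%:R.
Proof.
move=> f1 d; rewrite wcoef_conv.
under eq_bigr do rewrite -expr2 f1 mul1r.
by rewrite sum_walsh mulKf// gt_eqF ?cube_card_gt0.
Qed.

Lemma wcoef_parseval f g :
  \sum_b (wcoef f b - wcoef g b) ^+ 2 = N^-1 * \sum_x (f x - g x) ^+ 2.
Proof.
transitivity (\sum_b wcoef (fun x => f x - g x) b *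
    wcoef (fun x => f x - g x) (symd b finset.set0)).
  apply: eq_bigr => b _; rewrite symd0 -expr2; congr (_ ^+ 2).
  rewrite /wcoef -mulrBr -sumrB; congr (_ * _); apply: eq_bigr => x _.
  by rewrite mulrBl.
rewrite wcoef_conv; congr (_ * _); apply: eq_bigr => x _.
by rewrite /walsh finset.set0I cards0 mulr1 expr2.
Qed.

Definition majority F x : R := if (#|F| < #|x :&: F|%SET.*2)%N then 1 else -1.

Lemma majority_sqr F x : majority F x ^+ 2 = 1.
Proof. by rewrite /majority; case: ifP; rewrite ?sqrrN expr1n. Qed.

(** Complementing [x] reverses the vote, since an odd [F] admits no tie. *)
Lemma sum_majority F : odd #|F| -> \sum_x majority F x = 0.
Proof.
move=> oF; set S := \sum_x _; suff : S = - S by lra.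
rewrite {1}/S (reindex_inj (@finset.setC_inj J)) -sumrN; apply: eq_bigr => x _.
rewrite /majority.
have E : (#|F| = #|x :&: F| + #|~: x :&: F|)%SET.
  by rewrite -(finset.cardsID x F) finset.setIC finset.setDE [(F :&: _)%SET]finset.setIC.
have -> : (#|F| < #|~: x :&: F|%SET.*2)%N = ~~ (#|F| < #|x :&: F|%SET.*2)%N.
  by move: oF; rewrite E; lia.
by rewrite if_neg; case: ifP; rewrite ?opprK.
Qed.

Lemma wcoef_majority0 F : odd #|F| -> wcoef (majority F) finset.set0 = 0.
Proof.
move=> oF; rewrite /wcoef.
under eq_bigr do rewrite /walsh finset.set0I cards0 mulr1.
by rewrite sum_majority// mulr0.
Qed.

(** Toggling some [j] of [b] outside [F] leaves the vote unchanged and reverses the Walsh function.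
    So only products of involutions indexed by [F] enter the unitary, and an intertwining relation
    is asked for on subsets of [F] alone. *)
Lemma wcoef_majority_support F b : ~~ (b \subset F) -> wcoef (majority F) b = 0.
Proof.
move=> /subsetPn[j jb jF]; rewrite /wcoef; set S := \sum_x _.
suff -> : S = 0 by rewrite mulr0.
suff : S = - S by lra.
rewrite {1}/S (reindex_inj (inv_inj (symdK [set j]%SET))) -sumrN.
apply: eq_bigr => x _; rewrite walshC -walshM ![walsh _ b]walshC.
have -> : walsh b [set j]%SET = -1.
  rewrite /walsh (_ : (b :&: [set j])%SET = [set j]%SET) ?cards1//.
  by apply/finset.setIidPr; rewrite finset.sub1set.
rewrite mulN1r mulrN /majority.
suff -> : (symd [set j] x :&: F = x :&: F)%SET by [].
apply/setP => i; rewrite !inE.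
by case: eqP => // ->; rewrite (negPf jF) !andbF.
Qed.

Lemma walsh_perm (s : {perm J}) b x : walsh (s @: b)%SET (s @: x)%SET = walsh b x.
Proof.
rewrite /walsh -imsetI; last by apply: in2W; exact: perm_inj.
by rewrite !card_imset//; exact: perm_inj.
Qed.

Lemma majority_perm (s : {perm J}) F x :
  majority (s @: F)%SET (s @: x)%SET = majority F x.
Proof.
rewrite /majority -imsetI; last by apply: in2W; exact: perm_inj.
by rewrite !card_imset//; exact: perm_inj.
Qed.

Lemma wcoef_majority_perm (s : {perm J}) F b :
  wcoef (majority (s @: F)%SET) (s @: b)%SET = wcoef (majority F) b.
Proof.
rewrite /wcoef; congr (_ * _).
rewrite (reindex_inj (imset_inj (@perm_inj _ s))); apply: eq_bigr => x _.
by rewrite walsh_perm majority_perm.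
Qed.

(** A second moment: for uniform [x] the difference is half a sum of orthogonal signs, one for each
    element of the symmetric difference. Equal cardinalities make the mean vanish. *)
Lemma card_deviation F F' : #|F| = #|F'| ->
  N^-1 * \sum_x (#|x :&: F|%SET%:R - #|x :&: F'|%SET%:R) ^+ 2 =
  #|symd F F'|%:R / 4.
Proof.
move=> FF'; pose g x : R := #|x :&: F|%SET%:R - #|x :&: F'|%SET%:R.
pose a j : R := (j \in F)%:R - (j \in F')%:R.
have cardE (A : {set J}) x :
    #|x :&: A|%SET%:R = \sum_j (j \in A)%:R * (1 - walsh [set j]%SET x) / 2 :> R.
  rewrite -sum1_card natr_sum big_mkcond; apply: eq_bigr => j _; rewrite inE.
  have -> : walsh [set j]%SET x = if j \in x then -1 else 1.
    rewrite /walsh; case: ifP => jx.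
      by rewrite (finset.setIidPl _) ?finset.sub1set// cards1.
    rewrite (_ : ([set j] :&: x)%SET = finset.set0) ?cards0//.
    by apply/setP => i; rewrite !inE; case: eqP => // ->; rewrite jx.
  by case: (j \in x); case: (j \in A) => /=; field.
have a0 : \sum_j a j = 0.
  have cE (A : {set J}) : \sum_j (j \in A)%:R = #|A|%:R :> R.
    rewrite -sum1_card natr_sum [RHS]big_mkcond; apply: eq_bigr => j _.
    by case: (j \in A).
  by rewrite sumrB !cE FF' subrr.
have gE x : g x = - 2^-1 * \sum_j a j * walsh [set j]%SET x.
  rewrite /g !cardE -sumrB; apply/eqP; rewrite -subr_eq0 mulr_sumr -sumrB.
  rewrite (eq_bigr (fun j => 2^-1 * a j)); first by rewrite -mulr_sumr a0 mulr0.
  by move=> j _; rewrite /a; field.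
under eq_bigr do rewrite -/(g _) gE exprMn.
rewrite -mulr_sumr.
have E : \sum_x (\sum_j a j * walsh [set j]%SET x) ^+ 2 = N * \sum_j a j ^+ 2.
  transitivity (\sum_i \sum_j \sum_x a i * a j * walsh (symd [set i] [set j])%SET x).
    transitivity (\sum_x \sum_i \sum_j a i * a j * walsh (symd [set i] [set j])%SET x).
      apply: eq_bigr => x _; rewrite expr2 mulr_suml; apply: eq_bigr => i _.
      by rewrite mulr_sumr; apply: eq_bigr => j _; rewrite -walshM; ring.
    by rewrite exchange_big; apply: eq_bigr => i _; rewrite exchange_big.
  rewrite mulr_sumr; apply: eq_bigr => i _.
  rewrite (bigD1 i)//= [X in _ + X]big1 ?addr0 => [|j ji].
    by rewrite -mulr_sumr sum_walsh symdd eqxx mulr1 mulrC expr2.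
  rewrite -mulr_sumr sum_walsh (_ : (_ == _) = false) ?mulr0//.
  apply/eqP => /setP /(_ i); rewrite in_symd !inE eqxx.
  by rewrite eq_sym (negPf ji).
rewrite E mulrCA mulKf ?gt_eqF ?cube_card_gt0//.
have -> : \sum_j a j ^+ 2 = #|symd F F'|%:R.
  rewrite -sum1_card natr_sum [RHS]big_mkcond; apply: eq_bigr => j _.
  rewrite in_symd /a; case: (j \in F); case: (j \in F') => /=;
  by rewrite ?subrr ?subr0 ?sub0r ?sqrrN ?expr1n ?expr0n.
by field.
Qed.

End WalshFunctions.

(** * Binomial estimates and stability of the majority vote *)

(** Through the recurrence [E] the induction step comes down to [(2k+1)(2k+3) <= (2k+2)^2]. The
    bound says that the central binomial probability is at most one over the square root of
    [2k+1]. *)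
Lemma central_bin_sqr k : ('C(k.*2, k) ^ 2 * k.*2.+1 <= 16 ^ k)%N.
Proof.
elim: k => [|k IH]; first by rewrite bin0.
have E : (k.+1 * 'C(k.+1.*2, k.+1) = 2 * k.*2.+1 * 'C(k.*2, k))%N.
  have h1 := mul_bin_diag k.*2.+2 k.
  have h2 := mul_bin_down k.*2.+1 k; rewrite /= in h1 h2.
  rewrite doubleS; apply/eqP; rewrite -(eqn_pmul2l (ltn0Sn k)).
  rewrite -h1; have -> : (k.*2.+2 = 2 * k.+1)%N by lia.
  have : (k.*2.+1 - k = k.+1)%N by lia.
  move=> e; rewrite e in h2.
  by apply/eqP; nia.
rewrite -(@leq_pmul2l (k.+1 ^ 2))// mulnA -expnMn E expnMn [(16 ^ _)%N]expnS.
have -> : ((2 * k.*2.+1) ^ 2 * 'C(k.*2, k) ^ 2 * k.+1.*2.+1 =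
  4 * (k.*2.+1 * k.+1.*2.+1) * ('C(k.*2, k) ^ 2 * k.*2.+1))%N by ring.
have -> : (k.+1 ^ 2 * (16 * 16 ^ k) = 16 * k.+1 ^ 2 * 16 ^ k)%N by ring.
apply: leq_mul => //; rewrite -!muln2; nia.
Qed.

Lemma leq_bin_middle k m : ('C(k.*2.+1, m) <= 'C(k.*2.+1, k))%N.
Proof.
have low j : (j <= k)%N -> ('C(k.*2.+1, k - j) <= 'C(k.*2.+1, k))%N.
  elim: j => [|j IH] jk; first by rewrite subn0.
  apply: leq_trans (IH (ltnW jk)).
  rewrite subnS; have [i ki] : exists i, (k - j = i.+1)%N by exists (k - j).-1; lia.
  rewrite ki /= -(@leq_pmul2l i.+1)// mul_bin_left leq_mul2r; apply/orP; right.
  lia.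
have [mk|mk] := leqP m k; first by rewrite -(subKn mk) low// leq_subr.
have [mn|mn] := leqP m k.*2.+1; last by rewrite bin_small.
rewrite -bin_sub//; have -> : (k.*2.+1 - m = k - (k - (k.*2.+1 - m)))%N by lia.
by apply: low; lia.
Qed.

Section MajorityStability.
Variables (R : realType) (J : finType).
Implicit Types (x F : {set J}).

Local Notation N := (#|{set J}|%:R : R).

Lemma card_slice F m :
  (#|[set x : {set J} | #|x :&: F| == m]%SET| <= 'C(#|F|, m) * 2 ^ (#|J| - #|F|))%N.
Proof.
pose A := [set y : {set J} | y \subset F & #|y| == m]%SET.
have -> : ('C(#|F|, m) * 2 ^ (#|J| - #|F|) = #|finset.setX A (powerset (~: F))|)%N.
  by rewrite cardsX cards_draws card_powerset [#|~: F|%SET]cardsCs finset.setCK.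
rewrite -(@card_in_imset _ _ (fun x => (x :&: F, x :&: ~: F)%SET)).
  apply: subset_leq_card; apply/fintype.subsetP => _ /imsetP[x + ->].
  by rewrite !inE/= => ->; rewrite !finset.subsetIr.
by move=> x y _ _ [E1 E2]; rewrite -(finset.setID x F) -[RHS](finset.setID y F) !finset.setDE E1 E2.
Qed.

(** Counting sets by their traces on [F] and on its complement leaves a binomial coefficient of an
    odd row, which is at most twice the central one of the preceding row. *)
Lemma slice_density F m k : #|F| = k.*2.+1 ->
  N^-1 * #|[set x : {set J} | #|x :&: F| == m]%SET|%:R <=
  (Num.sqrt k.*2.+1%:R)^-1.
Proof.
move=> Fk; rewrite ler_pdivrMl ?cube_card_gt0//.
have FJ : (#|F| <= #|J|)%N by exact: max_card.
apply: (@le_trans _ _ ('C(k.*2.+1, k) * 2 ^ (#|J| - #|F|))%:R).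
  rewrite ler_nat; apply: leq_trans (card_slice _ _) _.
  by rewrite leq_mul2r Fk leq_bin_middle orbT.
have -> : #|{set J}| = (2 ^ #|F| * 2 ^ (#|J| - #|F|))%N.
  by rewrite -expnD subnKC// -[LHS]cardsT -powersetT card_powerset cardsT.
rewrite !natrM mulrAC ler_pM2r ?ltr0n ?expn_gt0//.
have s0 : 0 < Num.sqrt (k.*2.+1%:R : R) by rewrite sqrtr_gt0 ltr0n.
rewrite ler_pdivlMr// -ler_sqr ?nnegrE ?ler0n//.
rewrite exprMn sqr_sqrtr// -!natrX -natrM ler_nat Fk.
have h := mul_bin_down k.*2.+1 k; rewrite /= in h.
have e : (k.*2.+1 - k = k.+1)%N by lia.
rewrite e in h.
have le2 : ('C(k.*2.+1, k) <= 2 * 'C(k.*2, k))%N.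
  rewrite -(@leq_pmul2l k.+1)// -h mulnA leq_mul2r; apply/orP; right; lia.
apply: (@leq_trans ((2 * 'C(k.*2, k)) ^ 2 * k.*2.+1)%N).
  by rewrite leq_mul2r leq_sqr le2 orbT.
have -> : ((2 ^ k.*2.+1) ^ 2 = 2 ^ 2 * 16 ^ k)%N.
  by rewrite -(expnM 2 4) -expnM -expnD; congr (2 ^ _)%N; lia.
by rewrite expnMn -mulnA leq_pmul2l// central_bin_sqr.
Qed.

(* If the majorities over [F] and [F'] differ, then either [#|x :&: F|] and
   [#|x :&: F'|] are at least [L] apart or [#|x :&: F|] lies within [L] of
   the threshold. *)
Lemma majority_diff F F' x k L : #|F| = k.*2.+1 -> #|F'| = k.*2.+1 -> (0 < L)%N ->
  (majority R F x - majority R F' x) ^+ 2 <=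
  4 * (\sum_(i < L.*2) (#|x :&: F|%SET + L == k.+1 + i)%N%:R +
       (#|x :&: F|%SET%:R - #|x :&: F'|%SET%:R) ^+ 2 / L%:R ^+ 2).
Proof.
move=> Fk F'k L0; set m := #|(x :&: F)%SET|; set m' := #|(x :&: F')%SET|.
have L0' : 0 < L%:R ^+ 2 :> R by rewrite exprn_gt0// ltr0n.
have D0 : 0 <= (m%:R - m'%:R : R) ^+ 2 / L%:R ^+ 2.
  by rewrite divr_ge0 ?sqr_ge0// ltW.
have S0 : 0 <= \sum_(i < L.*2) (m + L == k.+1 + i)%N%:R :> R.
  by apply: sumr_ge0.
have [E|ne] := boolP ((#|F| < m.*2)%N == (#|F'| < m'.*2)%N).
  rewrite /majority -/m -/m' (eqP E) subrr expr0n /=.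
  by rewrite mulr_ge0// addr_ge0.
have -> : (majority R F x - majority R F' x) ^+ 2 = 4 * 1.
  rewrite /majority -/m -/m'.
  by move: ne; case: (_ < _)%N; case: (_ < _)%N => //= _; ring.
rewrite ler_pM2l//.
have [far|near] := boolP ((m + L <= m') || (m' + L <= m))%N.
  apply: ler_wpDl => //; rewrite ler_pdivlMr// mul1r.
  case/orP: far => far.
    by rewrite -[leRHS]sqrrN opprB ler_sqr ?nnegrE ?subr_ge0 ?ler_nat ?lerBrDl -?natrD ?ler_nat//; lia.
  by rewrite ler_sqr ?nnegrE ?subr_ge0 ?ler_nat ?lerBrDl -?natrD ?ler_nat//; lia.
apply: ler_wpDr => //.
have iL : (m + L - k.+1 < L.*2)%N by move: ne near; rewrite Fk F'k; lia.
rewrite (bigD1 (Ordinal iL))//= (_ : (_ == _)%N).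
  by rewrite lerDl sumr_ge0.
by move: ne near; rewrite Fk F'k; lia.
Qed.

(** The average of [majority_diff]: each of the [2L] slices near the threshold has small density,
    and distant values of the two counts are rare by Chebyshev's inequality with the variance from
    [card_deviation]. *)
Lemma majority_stability F F' k L :
  #|F| = k.*2.+1 -> #|F'| = k.*2.+1 -> (0 < L)%N ->
  N^-1 * \sum_x (majority R F x - majority R F' x) ^+ 2 <=
  8 * L%:R / Num.sqrt k.*2.+1%:R + #|symd F F'|%:R / L%:R ^+ 2.
Proof.
move=> Fk F'k L0.
have N0 := cube_card_gt0 R J.
have H := ler_sum (index_enum {set J}) (P := predT)
  (fun x _ => majority_diff x Fk F'k L0).
rewrite -(ler_pM2l (x := N^-1)) ?invr_gt0// in H.
apply: le_trans H _.
rewrite -mulr_sumr mulrCA big_split /= mulrDr mulrDr lerD//.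
  rewrite exchange_big/= mulr_sumr.
  rewrite (_ : 8 * L%:R / _ = 4 * \sum_(i < L.*2) (Num.sqrt k.*2.+1%:R)^-1); last first.
    by rewrite sumr_const card_ord -[_ *+ L.*2]mulr_natr -[L.*2]mul2n natrM; ring.
  rewrite ler_pM2l// ler_sum// => i _.
  apply: (le_trans _ (slice_density (k.+1 + i - L)%N Fk)).
  rewrite ler_pM2l ?invr_gt0// -natr_sum ler_nat -sum1_card [leqRHS]big_mkcond.
  apply: leq_sum => x _; rewrite inE.
  by case: eqP => //= <-; rewrite addnK eqxx.
have q (u v : R) : 4 * (u / 4 * v) = u * v by field.
by rewrite -mulr_suml [N^-1 * _]mulrA card_deviation ?Fk ?F'k// q.
Qed.

End MajorityStability.

(** * From almost permuted involutions to almost central unitaries *)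

Section MajorityCriterion.
Variables (R : realType) (G : groupType).

(** Conjugation by [g] permutes the involutions of [F] as [s] does. The permutation is defined on
    all of [J] so that Walsh coefficients can be transported along it; [1 <= delta * #|F|%:R] makes
    [F] large enough for a stable vote. *)
Definition folner_flips (E : seq G) (delta : R) : Prop :=
  exists (J : finType) (h : {set J} -> G) (F : {set J}),
  [/\ {morph h : b d / symd b d >-> (b * d)%g}, injective h,
      odd #|F|, 1 <= delta * #|F|%:R
    & forall g, g \in E -> exists2 s : {perm J},
      forall b : {set J}, b \subset F -> (g * h b)%g = (h (s @: b)%SET * g)%g
      & #|(s @: F :\: F)%SET|%:R <= delta * #|F|%:R].

Lemma walsh_central_of_flips (E : seq G) (eps : R) : 0 < eps ->
  (forall delta, 0 < delta -> folner_flips E delta) -> walsh_central E eps.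
Proof.
(* The estimates below add up to [8 eta + 10 eta^2], at most [18 eta]; the factor 19 makes the final
   inequality strict. *)
move=> e0 flips; pose eta := Num.min 1 (eps / 19).
have eta0 : 0 < eta by rewrite lt_min ltr01 divr_gt0.
have eta1 : eta <= 1 by rewrite ge_min lexx.
have etae : eta * 19 <= eps by rewrite -ler_pdivlMr// ge_min lexx orbT.
have [J [h [F [hM hI oF nF hE]]]] := flips (eta ^+ 4) (exprn_gt0 4 eta0).
exists J, h, (wcoef (majority R F)); split=> //.
- by apply: wcoef_conv_sign => x; exact: majority_sqr.
- exact: wcoef_majority0.
move=> g /hE[s sb sF]; set F' := (s @: F)%SET in sF.
rewrite (normsq_walsh_diff_delta hM hI (k := wcoef (majority R F'))); last first.
  rewrite [RHS](reindex_inj (imset_inj (@perm_inj _ s))); apply: eq_bigr => b _.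
  rewrite wcoef_majority_perm; have [bF|bF] := boolP (b \subset F).
    by rewrite sb.
  by rewrite wcoef_majority_support// rmorph0 !scale0r.
rewrite wcoef_parseval.
have Fk : #|F| = (#|F|./2).*2.+1 by rewrite -[LHS]odd_double_half oF.
have F'F : #|F'| = #|F| by rewrite card_imset//; exact: perm_inj.
set n := #|F| in Fk nF sF F'F.
pose r : R := Num.sqrt n%:R.
have n0 : 0 < n%:R :> R by rewrite ltr0n Fk.
have r0 : 0 < r by rewrite sqrtr_gt0.
have rr : r ^+ 2 = n%:R by rewrite sqr_sqrtr// ltW.
have y0 : 0 <= eta * r by rewrite mulr_ge0// ltW.
(* For [L] just above [eta * r] the slices contribute about [8 eta] and the deviations at most
   [2 eta^2]. Rounding up costs [8 / r], which is at most [8 eta^2] because [eta^4 n >= 1]. *)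
pose L := (Num.truncn (eta * r)).+1.
have /andP[L1 L2] := truncn_itv y0; rewrite -/L in L2.
have L1' : L%:R <= eta * r + 1 by rewrite /L -natr1 lerD2r.
apply: le_lt_trans (majority_stability R (k := n./2) (L := L) _ _ _) _ => //.
  by rewrite F'F.
rewrite -Fk -/r.
have symdE : #|symd F' F|%:R <= 2 * eta ^+ 4 * n%:R.
  have -> : #|symd F' F| = (2 * #|(F' :\: F)%SET|)%N.
    have -> : symd F' F = ((F' :\: F) :|: (F :\: F'))%SET.
      by apply/setP => j; rewrite !inE; case: (j \in F); case: (j \in F').
    rewrite cardsU (_ : (_ :&: _)%SET = finset.set0) ?cards0 ?subn0; last first.
      by apply/setP => j; rewrite !inE; case: (j \in F); case: (j \in F').
    have -> : #|(F :\: F')%SET| = #|(F' :\: F)%SET|.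
      apply/eqP; rewrite -(eqn_add2l #|(F' :&: F)%SET|) finset.cardsID.
      by rewrite finset.setIC finset.cardsID F'F.
    by rewrite addnn mul2n.
  by rewrite natrM -mulrA ler_pM2l.
have b1 : 8 * L%:R / r <= 8 * eta + 8 * eta ^+ 2.
  rewrite ler_pdivrMr//.
  have : 1 <= eta ^+ 2 * r.
    have le1 : 1 ^+ 2 <= (eta ^+ 2 * r) ^+ 2.
      by rewrite expr1n exprMn rr -exprM.
    have ge0 : 0 <= eta ^+ 2 * r by rewrite mulr_ge0 ?sqr_ge0 ?(ltW r0).
    by rewrite -[_ <= _]ler_sqr// nnegrE.
  by nra.
have b2 : #|symd F' F|%:R / L%:R ^+ 2 <= 2 * eta ^+ 2.
  rewrite ler_pdivrMr ?exprn_gt0 ?ltr0n//; apply: le_trans symdE _.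
  have : eta ^+ 2 * n%:R <= L%:R ^+ 2.
    by rewrite -rr -exprMn ler_sqr ?nnegrE ?ler0n// ltW.
  have : 0 < eta ^+ 2 by exact: exprn_gt0.
  have -> : eta ^+ 4 = eta ^+ 2 * eta ^+ 2 by rewrite -exprD.
  by nra.
have : eta ^+ 2 <= eta by rewrite expr2 ler_piMl// ltW.
by lra.
Qed.

Lemma factor_property_Gamma_of_flips :
  (forall E delta, 0 < delta -> folner_flips E delta) ->
  factor_property_Gamma (@group_vN R G) (@group_trace R G).
Proof.
move=> flips; apply: factor_property_Gamma_of_walsh => E eps e0.
by apply: walsh_central_of_flips => // delta; exact: flips.
Qed.

End MajorityCriterion.

(** * Folner sets from an invariant mean *)

(* A Hahn-Banach argument carried out one coordinate at a time: a linear
   functional below the sublinear functional [s |-> \sum_i |D i s|] that still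
   dominates [eps * size s] on the cone of finite multisets of [T]. *)
Section FlowExists.
Variables (R : realType) (T : Type) (d : nat -> T -> int) (eps : R).
Implicit Types (s : seq T) (l : seq R).

Definition seq_flow i s : int := \sum_(t <- s) d i t.
Local Notation D := seq_flow.

Definition flow_bound s N := forall i, (N <= i)%N -> D i s = 0.

Hypothesis d_expand : forall s N, flow_bound s N ->
  eps * (size s)%:R <= \sum_(i < N) (`|D i s|)%:~R.

Lemma seq_flow_cat i s s' : D i (s ++ s') = D i s + D i s'.
Proof. by rewrite /D big_cat. Qed.

Lemma seq_flow_nseq i k s : D i (flatten (nseq k s)) = D i s *+ k.
Proof.
elim: k => [|k IH]; first by rewrite /D big_nil mulr0n.
by rewrite /= seq_flow_cat IH mulrS.
Qed.

Let term l i s : R :=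
  if (i < size l)%N then l`_i * (D i s)%:~R else (`|D i s|)%:~R.

Let dominates l := forall s N, flow_bound s N ->
  eps * (size s)%:R <= \sum_(i < N) term l i s.

Let rest l s N : R :=
  \sum_(i < N | i != size l :> nat) term l i s - eps * (size s)%:R.

Let restE l s N : flow_bound s N ->
  \sum_(i < N) term l i s = rest l s N + (`|D (size l) s|)%:~R + eps * (size s)%:R.
Proof.
move=> sN; rewrite /rest addrAC subrK.
have [nN|Nn] := ltnP (size l) N.
  by rewrite (bigD1 (Ordinal nN))//= {1}/term ltnn addrC.
rewrite sN// normr0 addr0 [RHS]big_mkcond; apply: eq_bigr => i _.
by rewrite ltn_eqF// (leq_trans (ltn_ord i)).
Qed.

Let termD l i s s' : term l i (s ++ s') <= term l i s + term l i s'.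
Proof.
rewrite /term seq_flow_cat; case: ifP => _; first by rewrite rmorphD mulrDr.
by rewrite -rmorphD ler_int ler_normD.
Qed.

Let termZ l i s k : term l i (flatten (nseq k s)) = k%:R * term l i s.
Proof.
rewrite /term seq_flow_nseq; case: ifP => _.
  by rewrite rmorphMn/= -mulr_natl mulrCA.
by rewrite normrMn rmorphMn/= mulr_natl.
Qed.

Let restD l s s' N : rest l (s ++ s') N <= rest l s N + rest l s' N.
Proof.
rewrite /rest size_cat natrD mulrDr opprD addrACA lerD2r -big_split.
exact: ler_sum.
Qed.

Let restZ l s k N : rest l (flatten (nseq k s)) N = k%:R * rest l s N.
Proof.
rewrite /rest mulrBr mulr_sumr; congr (_ - _).
  by apply: eq_bigr => i _; exact: termZ.
by rewrite size_flatten /shape map_nseq sumn_nseq natrM; ring.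
Qed.

Let rest_bound l s N M : flow_bound s N -> (N <= M)%N -> rest l s M = rest l s N.
Proof.
move=> sN NM; rewrite /rest; congr (_ - _).
rewrite [RHS](big_ord_widen_cond M (fun i => i != size l) (term l ^~ s))//.
rewrite big_mkcond [RHS]big_mkcond; apply: eq_bigr => i _.
case: ifP => //= _; case: ltnP => // /sN.
by rewrite /term => ->; rewrite normr0 mulr0 if_same.
Qed.

(** Multisets with positive [n]-th coordinate bound the new coefficient from below, those with
    negative coordinate from above. Two such bounds are compatible because a positive combination of
    the two multisets has vanishing coordinate, and there [dominates l] applies. The supremum of the
    lower bounds is then a valid choice. *)
Let extend l : dominates l -> exists c, `|c| <= 1 /\ dominates (rcons l c).
Proof.
move=> dl; pose n := size l.
have dl' s N : flow_bound s N -> - (`|D n s|)%:~R <= rest l s N.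
  by move=> sN; have := dl s N sN; rewrite restE// -/n; lra.
pose A := [set c : R | c = -1 \/ exists s N, [/\ flow_bound s N, 0 < D n s &
  c = - rest l s N / (D n s)%:~R]].
have Aup c s N : A c -> flow_bound s N -> D n s < 0 ->
    c * (- D n s)%:~R <= rest l s N.
  move=> Ac sN Ds; case: Ac => [->|[s' [N' [s'N' Ds' ->]]]].
    by have := dl' s N sN; rewrite ltr0_norm// !rmorphN/=; lra.
  pose a := `|D n s'|%N; pose b := `|D n s|%N.
  have aE : (a%:R : R) = (D n s')%:~R.
    by rewrite -[in RHS](gtz0_abs Ds') pmulrn.
  have bE : (b%:R : R) = (- D n s)%:~R.
    by rewrite -[in RHS](ltz0_abs Ds) pmulrn.
  have a0 : 0 < a%:R :> R by rewrite aE ltr0z.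
  pose M := maxn N N'.
  have NM : (N <= M)%N by rewrite leq_maxl.
  have N'M : (N' <= M)%N by rewrite leq_maxr.
  rewrite -(rest_bound l sN NM) -(rest_bound l s'N' N'M) -aE -bE.
  rewrite mulrAC ler_pdivrMr//.
  (* Coordinates are integers, so these multiplicities cancel the [n]-th one without leaving the
     multisets. *)
  pose u := flatten (nseq b s') ++ flatten (nseq a s).
  have uM : flow_bound u M.
    move=> i Mi; rewrite seq_flow_cat !seq_flow_nseq sN ?s'N' ?mul0rn ?addr0//.
      exact: leq_trans N'M Mi.
    exact: leq_trans NM Mi.
  have := dl' u M uM.
  have -> : D n u = 0.
    have aE' : D n s' = a%:Z by rewrite /a gtz0_abs.
    have bE' : D n s = - b%:Z by rewrite /b ltz0_abs ?opprK.
    rewrite seq_flow_cat !seq_flow_nseq aE' bE' mulNrn -[a%:Z]natz -[b%:Z]natz.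
    by rewrite -!mulrnA mulnC subrr.
  rewrite normr0 oppr0 => /le_trans /(_ (restD _ _ _ _)).
  by rewrite !restZ; lra.
have A1 : ubound A 1.
  move=> c [->|[s [N [sN Ds ->]]]]; first by lra.
  rewrite ler_pdivrMr ?ltr0z// mul1r.
  by have := dl' s N sN; rewrite gtr0_norm//; lra.
have supA : has_sup A by split; [exists (-1); left|exists 1].
exists (sup A).
have Am1 : -1 <= sup A by apply: ub_le_sup; [exists 1|left].
split; first by rewrite ler_norml Am1 ge_sup//; exists (-1); left.
move=> s N sN.
have -> : \sum_(i < N) term (rcons l (sup A)) i s =
    rest l s N + sup A * (D n s)%:~R + eps * (size s)%:R.
  rewrite /rest addrAC subrK.
  have E i : i != n -> term (rcons l (sup A)) i s = term l i s.
    move=> im; rewrite /term size_rcons ltnS leq_eqVlt (negPf im) /=.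
    by case: ltnP => // il; rewrite nth_rcons il.
  have [nN|Nn] := ltnP n N.
    rewrite (bigD1 (Ordinal nN))//= [LHS]addrC; congr (_ + _).
      by apply: eq_bigr => i im; exact: E.
    by rewrite /term size_rcons ltnSn nth_rcons ltnn eqxx.
  rewrite sN// mulr0 addr0 [RHS]big_mkcond; apply: eq_bigr => i _.
  have im : i != n :> nat by rewrite ltn_eqF// (leq_trans (ltn_ord i)).
  by rewrite E// im.
rewrite -lerBlDr subrr.
have [Ds|Ds|Ds] := ltgtP (D n s) 0.
- have : sup A * (- D n s)%:~R <= rest l s N.
    rewrite -ler_pdivlMr ?ltr0z ?oppr_gt0//; apply: ge_sup; first by case: supA.
    by move=> c Ac; rewrite ler_pdivlMr ?ltr0z ?oppr_gt0// (Aup c).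
  by rewrite rmorphN/=; lra.
- have : - rest l s N / (D n s)%:~R <= sup A.
    by apply: ub_le_sup; [exists 1|right; exists s, N].
  by rewrite ler_pdivrMr ?ltr0z//; lra.
- by have := dl' s N sN; rewrite Ds normr0 mulr0 oppr0 addr0.
Qed.

Lemma flow_exists : exists f : nat -> R, (forall i, `|f i| <= 1) /\
  forall t N, flow_bound [:: t] N -> eps <= \sum_(i < N) f i * (d i t)%:~R.
Proof.
have step l : exists c, dominates l -> `|c| <= 1 /\ dominates (rcons l c).
  have [/extend[c cP]|nd] := pselect (dominates l); first by exists c.
  by exists 0 => /nd.
have {step}[c cP] := choice step.
pose F := fix F n := if n is n'.+1 then rcons (F n') (c (F n')) else [::].
have sF n : size (F n) = n by elim: n => //= n IH; rewrite size_rcons IH.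
have dF n : dominates (F n).
  elim: n => [|n IH] /=; last by case: (cP _ IH).
  by move=> s N sN; exact: d_expand.
pose f i := c (F i).
have FE n i : (i < n)%N -> (F n)`_i = f i.
  elim: n => //= n IH; rewrite ltnS leq_eqVlt nth_rcons sF => /orP[/eqP ->|im].
    by rewrite ltnn eqxx.
  by rewrite im IH.
exists f; split=> [i|t N tN]; first by case: (cP _ (dF i)).
have := dF N _ _ tN; rewrite mulr1 => /le_trans; apply.
apply: ler_sum => i _; rewrite /term sF ltn_ord FE//.
by rewrite /D big_seq1.
Qed.

End FlowExists.

Section Folner.
Variables (R : realType) (Gamma : groupType).
Implicit Types (s F K : seq Gamma) (eps : R).

Lemma invariant_mean_sum (m : (Gamma -> R) -> R) (I : Type) (r : seq I)
    (f : I -> Gamma -> R) : is_invariant_mean m ->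
  (forall i, exists M : R, forall t, `|f i t| <= M) ->
  (exists M : R, forall t, `|\sum_(i <- r) f i t| <= M) /\
  m (fun t => \sum_(i <- r) f i t) = \sum_(i <- r) m (f i).
Proof.
move=> [ml _ _ _] fb.
have b0 : exists M : R, forall t, `|(fun _ : Gamma => 0 : R) t| <= M.
  by exists 0 => u; rewrite normr0.
elim: r => [|i r [[M IHb] IH]].
  split; first by exists 0 => u; rewrite big_nil normr0.
  rewrite big_nil; under eq_fun do rewrite big_nil.
  have := ml (-1) _ _ b0 b0; rewrite (_ : (fun _ => _) = fun=> 0).
    by move=> ->; lra.
  by apply/funext => u; rewrite mulr0 addr0.
have [Mi Hi] := fb i.
under [in X in m X]eq_fun do rewrite big_cons -[f i _]mul1r.
rewrite ml ?mul1r ?big_cons ?IH; [|exact: fb|by exists M].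
split=> //; exists (Mi + M) => t; rewrite big_cons.
by apply: le_trans (ler_normD _ _) _; exact: lerD.
Qed.

Definition folner_set eps K F : Prop := forall k, k \in K ->
  (count (fun x => (k * x)%g \notin F) F)%:R <= eps * (size F)%:R.

Section NoFolner.
Variables (K : seq Gamma) (eps : R) (code : nat -> Gamma -> nat).
Hypothesis code_inj : forall j x j' x', code j x = code j' x' -> j = j' /\ x = x'.
Hypothesis no_folner : forall F, uniq F -> F != [::] -> ~ folner_set eps K F.

(* [code j x] numbers the edge from [x] to [k x], where [k] is the [j]-th
   element of [K]; [bdry n t] is the coefficient at that edge of the
   coboundary of the indicator function of [t]. *)
Let kth j : Gamma := nth 1%g K j.

Let bdry n t : int := \sum_(j < size K)
  ((code j ((kth j)^-1 * t)%g == n)%:Z - (code j t == n)%:Z).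

Let bdry_code1 (j : 'I_(size K)) x t :
  bdry (code j x) t = (t == kth j * x)%g%:Z - (t == x)%:Z.
Proof.
rewrite /bdry (bigD1 j)//= big1 ?addr0 => [|i ij].
  congr (Posz (nat_of_bool _) - Posz (nat_of_bool _)); apply/eqP/eqP.
  - by move=> /code_inj[_ <-]; rewrite mulVKg.
  - by move=> ->; rewrite mulKg.
  - by move=> /code_inj[].
  - by move=> ->.
have ne y : code i y == code j x = false.
  by apply/eqP => /code_inj[E _]; rewrite (val_inj E) eqxx in ij.
by rewrite !ne subrr.
Qed.

Let bdry_code (j : 'I_(size K)) x s :
  seq_flow bdry (code j x) s =
  (count_mem (kth j * x)%g s)%:Z - (count_mem x s)%:Z.
Proof.
elim: s => [|t s IH]; first by rewrite /seq_flow big_nil.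
rewrite -cat1s seq_flow_cat IH {1}/seq_flow big_seq1 bdry_code1 /=.
by rewrite !PoszD opprD addrACA.
Qed.

Let bdry_noncode n s : (forall (j : 'I_(size K)) x, code j x <> n) ->
  seq_flow bdry n s = 0.
Proof.
move=> nc; rewrite /seq_flow big1// => t _; rewrite /bdry big1// => j _.
have ne y : code j y == n = false by apply/eqP/nc.
by rewrite !ne subrr.
Qed.

Let code_or n : (exists (j : 'I_(size K)) x, n = code j x) \/
  (forall (j : 'I_(size K)) x, code j x <> n).
Proof.
have [h|h] := pselect (exists (j : 'I_(size K)) x, n = code j x); first by left.
by right=> j x E; apply: h; exists j, x.
Qed.

(** An element [k] violating the Folner condition gives more than [eps * size F] edges from [F] to
    its complement, and at each of them the coboundary has absolute value 1. *)
Let expand_uniq F N : uniq F -> flow_bound bdry F N ->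
  eps * (size F)%:R <= \sum_(i < N) (`|seq_flow bdry i F|)%:~R.
Proof.
move=> uF FN; have [->|F0] := eqVneq F [::].
  by rewrite mulr0 sumr_ge0.
have [k [kK kF]] : exists k, k \in K /\
    eps * (size F)%:R < (count (fun x => (k * x)%g \notin F) F)%:R.
  apply: contrapT => h; apply: (no_folner uF F0) => k kK.
  by rewrite leNgt; apply/negP => kF; apply: h; exists k.
have jK : (index k K < size K)%N by rewrite index_mem.
pose j := Ordinal jK; have jk : kth j = k by rewrite /kth nth_index.
pose L := [seq code j x | x <- [seq x <- F | (k * x)%g \notin F]].
have uL : uniq L.
  by rewrite map_inj_uniq ?filter_uniq// => x y /code_inj[].
have LD n : n \in L -> `|seq_flow bdry n F| = 1.
  move=> /mapP[x]; rewrite mem_filter => /andP[kx xF] ->.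
  by rewrite bdry_code jk count_uniq_mem// (negPf kx) count_uniq_mem// xF.
have LN n : n \in L -> (n < N)%N.
  move=> nL; rewrite ltnNge; apply/negP => /FN E.
  by have := LD n nL; rewrite E normr0.
apply: (le_trans (ltW kF)); rewrite -size_filter -(size_map (code j)) -/L.
have -> : size L = (\sum_(i < N) ((i : nat) \in L : nat))%N.
  rewrite -(big_mkord xpredT (fun i : nat => (i \in L : nat))) -[LHS]sum1_size.
  have pL : perm_eq L [seq i <- iota 0 N | i \in L].
    apply: uniq_perm; rewrite ?filter_uniq ?iota_uniq// => n.
    by rewrite mem_filter mem_iota add0n leq0n /=; case: (boolP (n \in L)) => // /LN.
  rewrite (perm_big _ pL).
  rewrite big_filter big_mkcond /index_iota subn0; apply: eq_bigr => i _.
  by case: (i \in L).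
rewrite natr_sum; apply: ler_sum => i _; case: (boolP (_ \in L)) => [/LD ->//|_].
by rewrite ler0z.
Qed.

(* The co-area formula, one level set at a time. *)
Let expand s N : flow_bound bdry s N ->
  eps * (size s)%:R <= \sum_(i < N) (`|seq_flow bdry i s|)%:~R.
Proof.
have [n sn] := ubnP (size s); elim: n => // n IH in s N sn *.
have [->|s0 sN] := eqVneq s [::]; first by rewrite mulr0 sumr_ge0.
have [t tP] := perm_to_subseq (undup_subseq s).
have cnt x : count_mem x s = ((x \in s) + count_mem x t)%N.
  by move/seq.permP: tP => ->; rewrite count_cat count_uniq_mem ?undup_uniq// mem_undup.
(* No cancellation: if exactly one end of an edge lies in [s], the other end has multiplicity 0 in
   [t] as well, so both contributions have the same sign. *)
have D i : `|seq_flow bdry i s| =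
    `|seq_flow bdry i (undup s)| + `|seq_flow bdry i t|.
  have [[j [x ->]]|nc] := code_or i; last by rewrite !bdry_noncode// normr0.
  rewrite !bdry_code !(count_uniq_mem _ (undup_uniq s)) !mem_undup !cnt.
  have memt y : (y \in t) -> y \in s.
    by rewrite (perm_mem tP) mem_cat => ->; rewrite orbT.
  have c0 y : (y \in s) = false -> count_mem y t = 0%N.
    by move=> ys; apply/count_memPn/negP => /memt; rewrite ys.
  set y := (kth j * x)%g; have := c0 y; have := c0 x.
  case: (y \in s); case: (x \in s) => /= hx hy; first lia.
  - by rewrite hx//; lia.
  - by rewrite hy//; lia.
  - by rewrite hx// hy.
have sE : size s = (size (undup s) + size t)%N by rewrite (perm_size tP) size_cat.
have us0 : (0 < size (undup s))%N.
  by case: s s0 {sN sn tP cnt D sE} => // x s _; rewrite -has_predT; apply/hasP;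
    exists x; rewrite ?mem_undup ?mem_head.
have zero i : (N <= i)%N -> seq_flow bdry i (undup s) = 0 /\ seq_flow bdry i t = 0.
  move=> /sN E; have := D i; rewrite E normr0 => /esym/eqP.
  by rewrite paddr_eq0// !normr_eq0 => /andP[/eqP -> /eqP ->].
rewrite sE natrD mulrDr.
under eq_bigr do rewrite D rmorphD.
rewrite big_split lerD//.
  by apply: expand_uniq; [exact: undup_uniq|move=> i /zero[]].
apply: (IH t N); last by move=> i /zero[].
by rewrite sE ltnS in sn; apply: leq_trans sn; rewrite -[ltnLHS]add0n ltn_add2r.
Qed.

(** The dual form of the absence of Folner sets: a bounded flow on the edges of the Cayley graph,
    with net inflow at least [eps] at every vertex. *)
Lemma no_folner_flow : exists f : nat -> R, (forall i, `|f i| <= 1) /\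
  forall t, eps <= \sum_(j < size K)
    (f (code j ((nth 1%g K j)^-1 * t)%g) - f (code j t)).
Proof.
have [f [f1 fP]] := flow_exists expand.
exists f; split=> // t.
pose M := \max_(j < size K) (maxn (code j ((kth j)^-1 * t)%g) (code j t)).
have MP (j : 'I_(size K)) : (code j ((kth j)^-1 * t)%g < M.+1)%N /\ (code j t < M.+1)%N.
  have := leq_bigmax (F := fun j : 'I_(size K) => maxn (code j ((kth j)^-1 * t)%g) (code j t)) j.
  by rewrite -/M geq_max !ltnS => /andP[].
have bM : flow_bound bdry [:: t] M.+1.
  move=> n nM; rewrite /seq_flow big_seq1 /bdry big1// => j _.
  have [h1 h2] := MP j.
  by rewrite !ltn_eqF// (leq_trans _ nM).
apply: le_trans (fP t _ bM) _.
rewrite le_eqVlt; apply/orP; left; apply/eqP.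
transitivity (\sum_(i < M.+1) \sum_(j < size K)
    (f i * (code j ((kth j)^-1 * t)%g == i)%:R - f i * (code j t == i)%:R)).
  apply: eq_bigr => i _; rewrite /bdry rmorph_sum mulr_sumr.
  by apply: eq_bigr => j _; rewrite rmorphB mulrBr.
rewrite exchange_big; apply: eq_bigr => j _; rewrite sumrB.
have pick n : (n < M.+1)%N -> \sum_(i < M.+1) f i * (n == i)%:R = f n.
  move=> nM; rewrite (bigD1 (Ordinal nM))//= eqxx mulr1 big1 ?addr0// => i im.
  case: eqP => [ni|_]; last by rewrite mulr0.
  by move: im; rewrite -val_eqE /= ni eqxx.
by have [h1 h2] := MP j; rewrite !pick.
Qed.

End NoFolner.

(** Otherwise the net inflow of [no_folner_flow] has mean at least [eps]; but it is a finite sum of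
    differences between a translate of a bounded function and the function itself, so its mean is
    0. *)
Lemma folner_exists K eps : countable [set: Gamma] -> amenable R Gamma ->
  0 < eps -> exists F, [/\ uniq F, F != [::] & folner_set eps K F].
Proof.
move=> /countable_injP[phi phi_inj] [m mP] e0; apply: contrapT => nF.
pose code j x := pickle (j : nat, phi x).
have code_inj j x j' x' : code j x = code j' x' -> j = j' /\ x = x'.
  move=> /(pcan_inj pickleK)[-> E]; split=> //.
  by apply: phi_inj; rewrite ?in_setT.
have [|f [f1 fP]] := @no_folner_flow K eps code code_inj.
  by move=> F uF F0 FF; apply: nF; exists F.
pose g (j : 'I_(size K)) t := f (code j ((nth 1%g K j)^-1 * t)%g) - f (code j t).
have [ml m0 m1 mI] := mP.
have bf (j : nat) : exists M : R, forall t, `|f (code j t)| <= M by exists 1.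
have bfk (j : nat) (k : Gamma) : exists M : R, forall t, `|f (code j (k * t)%g)| <= M.
  by exists 1.
have [|gb gm] := invariant_mean_sum (index_enum 'I_(size K)) (f := g) mP.
  move=> j; exists (1 + 1) => t; rewrite /g.
  by apply: le_trans (ler_normB _ _) _; exact: lerD.
have gm0 : m (fun t => \sum_j g j t) = 0.
  rewrite gm big1// => j _.
  have -> : g j = (fun t => -1 * f (code j t) + f (code j ((nth 1%g K j)^-1 * t)%g)).
    by apply/funext => t; rewrite /g mulN1r addrC.
  by rewrite ml// (mI _ (fun t => f (code j t)))// mulN1r addNr.
have b1 : exists M : R, forall t, `|(fun _ : Gamma => 1 : R) t| <= M.
  by exists 1 => t; rewrite normr1.
have [M gM] := gb.
have h1 : exists M : R, forall t, `|- eps * 1 + \sum_j g j t| <= M.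
  exists (eps + M) => t; apply: le_trans (ler_normD _ _) _.
  by rewrite mulr1 normrN (gtr0_norm e0) lerD.
have h2 t : 0 <= - eps * 1 + \sum_j g j t.
  by rewrite mulr1 addrC subr_ge0; exact: fP.
by have := m0 _ h1 h2; rewrite ml// m1 gm0; lra.
Qed.

End Folner.

(** * Large Folner sets of odd size *)

Section FolnerOdd.
Variables (R : realType) (Gamma : groupType).
Implicit Types F K L : seq Gamma.

(** Double counting of the pairs of [k] in [L] and [x] in [F] with [k * x] in [F]: each [x] admits
    at most [size F] elements [k], and each [k] keeps at least half of the [x]. *)
Lemma folner_set_large (eps : R) F L : eps <= 1 / 2 -> uniq F -> F != [::] -> uniq L ->
  folner_set eps L F -> (size L <= 2 * size F)%N.
Proof.
move=> e2 uF F0 uL LF.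
have sF : (0 < size F)%N by rewrite lt0n size_eq0.
have up : (\sum_(k <- L) count (fun x => (k * x)%g \in F) F <= size F * size F)%N.
  have -> : (\sum_(k <- L) count (fun x => (k * x)%g \in F) F =
      \sum_(x <- F) count (fun k => (k * x)%g \in F) L)%N.
    under eq_bigr do rewrite -sum1_count big_mkcond.
    by rewrite exchange_big; apply: eq_bigr => x _; rewrite -big_mkcond sum1_count.
  rewrite -[leqRHS]/(size F * size F)%N -{2}sum1_size big_distrr /=.
  apply: leq_sum => x _; rewrite muln1 -size_filter -(size_map (fun k => k * x)%g).
  apply: uniq_leq_size.
    by rewrite map_inj_uniq ?filter_uniq//; exact: mulIg.
  by move=> _ /mapP[k + ->]; rewrite mem_filter => /andP[].
have low : (\sum_(k <- L) size F <= \sum_(k <- L) 2 * count (fun x => (k * x)%g \in F) F)%N.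
  rewrite big_seq [leqRHS]big_seq; apply: leq_sum => k kL.
  have E : (count (fun x => (k * x)%g \in F) F +
      count (fun x => (k * x)%g \notin F) F = size F)%N := count_predC _ F.
  have := LF k kL; rewrite -(ler_pM2r (x := 2))//.
  have : eps * (size F)%:R * 2 <= (size F)%:R.
    by rewrite mulrAC -[leRHS]mul1r ler_wpM2r//; lra.
  move=> /[swap] /le_trans /[apply]; rewrite -natrM ler_nat -E.
  by rewrite muln2 mul2n -!addnn leq_add2r leq_add2l.
move: low; rewrite -big_distrr /= big_const_seq count_predT iter_addn_0 => low.
rewrite -(@leq_pmul2r (size F))// mulnC -mulnA; apply: leq_trans low _.
by rewrite leq_mul2l up orbT.
Qed.

Lemma folner_odd K (delta : R) : infinite_set [set: Gamma] -> countable [set: Gamma] ->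
  amenable R Gamma -> (0 : R) < delta ->
  exists F, [/\ uniq F, odd (size F), 1 <= delta * (size F)%:R &
    folner_set delta K F].
Proof.
move=> Ginf Gcount Gam d0.
pose e := Num.min (delta / 4) (1 / 2).
have e0 : 0 < e by rewrite lt_min !divr_gt0.
have ed : e <= delta / 4 by rewrite ge_min lexx.
have e2 : e <= 1 / 2 by rewrite ge_min lexx orbT.
(* Almost invariance under [N] further elements forces at least [N / 2] points, enough to leave room
   for dropping one. *)
pose N := (Num.truncn (4 * (1 + delta^-1))).+1.
have [A _ BN] := infinite_set_fset N Ginf; set B := finmap.enum_fset A in BN.
have [F [uF F0 FF]] := folner_exists (K ++ B) Gcount Gam e0.
have h : (N <= 2 * size F)%N.
  apply: leq_trans BN (folner_set_large e2 uF F0 (finmap.fset_uniq A) _).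
  by move=> k kB; apply: FF; rewrite mem_cat kB orbT.
have nF : 2 * (1 + delta^-1) <= (size F)%:R.
  have : 4 * (1 + delta^-1) < N%:R by exact: truncnS_gt.
  have : N%:R <= 2 * (size F)%:R :> R by rewrite -natrM ler_nat.
  by lra.
have nF' : 2 * delta + 2 <= delta * (size F)%:R.
  rewrite -(ler_pM2l d0) mulrCA mulrDr mulr1 mulfV ?gt_eqF// in nF.
  by apply: le_trans nF; lra.
have [oF|eF] := boolP (odd (size F)).
  exists F; split=> //; first by lra.
  move=> k kK; apply: le_trans (FF k _) _; first by rewrite mem_cat kK.
  by rewrite ler_wpM2r//; lra.
(* In the even case the point [x] is dropped. Besides the points that left [x :: F] already, only
   the one sent to [x] can leave now. *)
case: F uF F0 FF {h nF} nF' eF => [//|x F] /= /andP[xF uF] _ FF nF' eF.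
have sF : (size (x :: F))%:R = 1 + (size F)%:R :> R by rewrite -natr1 addrC.
rewrite sF in nF'.
exists F; split=> //; first by move: eF; rewrite /= negbK.
  by lra.
move=> k kK.
have := FF k; rewrite mem_cat kK sF => /(_ isT) h.
have c1 : (count (fun y => (k * y)%g \notin F) F <=
    count (fun y => (k * y)%g \notin x :: F) (x :: F) + 1)%N.
  pose q y := (k * y)%g \notin x :: F.
  have E : (count (predU q (pred1 (k^-1 * x)%g)) F <= count q F + 1)%N.
    rewrite -(leq_add2r (count (predI q (pred1 (k^-1 * x)%g)) F)).
    rewrite count_predUI (count_uniq_mem _ uF).
    by rewrite -addnA leq_add2l (leq_trans (leq_b1 _))// leq_addr.
  apply: (@leq_trans (count (predU q (pred1 (k^-1 * x)%g)) F)).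
    apply: sub_count => y kyF; rewrite /= /q inE negb_or kyF andbT.
    by case: (eqVneq (k * y)%g x) => [<-|_]; rewrite ?mulKg ?eqxx ?orbT.
  by apply: leq_trans E _; rewrite /= leq_add2r leq_addl.
rewrite -(ler_nat R) natrD in c1.
apply: le_trans c1 _.
have : e * (1 + (size F)%:R) <= delta / 4 * (1 + (size F)%:R).
  by rewrite ler_wpM2r// addr_ge0.
by lra.
Qed.

End FolnerOdd.

(** * Towers of clopen sets over a free point *)

Section ClopenSets.
Variables (X : topologicalType) (T : finType).

Lemma clopen_forall (A : T -> set X) : (forall t, clopen (A t)) ->
  clopen [set x | forall t, A t x].
Proof.
move=> cA.
have cl (r : seq T) : clopen [set x | forall t, t \in r -> A t x].
  elim: r => [|t r IH].
    by rewrite (_ : [set _ | _] = setT); [exact: clopenT|apply/seteqP; split].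
  rewrite (_ : [set _ | _] = A t `&` [set x | forall t, t \in r -> A t x]).
    exact: clopenI.
  apply/seteqP; split=> x /=.
    move=> h; split; first by apply: h; rewrite mem_head.
    by move=> u ur; apply: h; rewrite inE ur orbT.
  by move=> [h1 h2] u; rewrite inE => /orP[/eqP ->|/h2].
rewrite (_ : [set x | _] = [set x | forall t, t \in enum T -> A t x])//.
by apply/seteqP; split=> x h t; [move=> _; exact: h|apply: h; rewrite mem_enum].
Qed.

Lemma clopen_common_nbhd (x : X) (Q : T -> set X -> Prop) :
  (forall t U V, U `<=` V -> Q t V -> Q t U) ->
  (forall t, exists U, [/\ clopen U, U x & Q t U]) ->
  exists U, [/\ clopen U, U x & forall t, Q t U].
Proof.
move=> Qmono /choice[A AP]; exists [set y | forall t, A t y]; split.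
- by apply: clopen_forall => t; case: (AP t).
- by move=> t; case: (AP t).
- by move=> t; case: (AP t) => _ _; apply: Qmono => y; exact.
Qed.

End ClopenSets.

Section Towers.
Variables (Gamma : groupType) (X : topologicalType).
Variable alpha : {multiplicative Gamma -> homeo X}.

Lemma hactM s t x : alpha (s * t)%g x = alpha s (alpha t x).
Proof. by rewrite gmulfM. Qed.

Lemma hact1 x : alpha 1%g x = x.
Proof.
have -> // : alpha 1%g = 1%g.
by apply: (mulgI (alpha 1%g)); rewrite -gmulfM !mulg1.
Qed.

Lemma hactK s : cancel (alpha s) (alpha s^-1%g).
Proof. by move=> x; rewrite -hactM mulVg hact1. Qed.

Lemma hactVK s : cancel (alpha s^-1%g) (alpha s).
Proof. by move=> x; rewrite -hactM mulgV hact1. Qed.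

Lemma clopen_preimage_act s (B : set X) : clopen B -> clopen (alpha s @^-1` B).
Proof. by move=> cB; apply: preimage_clopen => //; exact: homeo_fun_continuous. Qed.

Lemma full_group_of_partition (I : finType) (P : I -> set X) (s : I -> Gamma)
    (T : homeo X) :
  (forall x, exists i, P i x) -> (forall i j x, P i x -> P j x -> i = j) ->
  (forall i, clopen (P i)) -> (forall i x, P i x -> T x = alpha (s i) x) ->
  full_group alpha T.
Proof.
(* The pieces of a [partition] are required to be nonempty, so the empty ones are discarded. *)
move=> cov dis cl Ts; pose e := [seq i <- enum I | `[< P i !=set0 >]].
have eP i : i \in e = `[< P i !=set0 >] by rewrite mem_filter mem_enum andbT.
exists (size e), (fun k => P (tnth (in_tuple e) k)), (fun k => s (tnth (in_tuple e) k)).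
split=> //; last by move=> k x; exact: Ts.
split.
- apply/seteqP; split=> // x _; have [i Pix] := cov x.
  have ie : i \in e by rewrite eP; apply/asboolP; exists x.
  have ie' : (index i e < size e)%N by rewrite index_mem.
  by exists (Ordinal ie') => //; rewrite (tnth_nth i)/= nth_index.
- move=> k l _ _ [x [Pk Pl]]; have E := dis _ _ _ Pk Pl.
  apply: val_inj; have i0 := tnth (in_tuple e) k.
  move: E; rewrite !(tnth_nth i0) /= => /eqP; rewrite nth_uniq// => [/eqP//|].
  by rewrite filter_uniq// enum_uniq.
- move=> k _; have := mem_tnth k (in_tuple e).
  by rewrite -[_ \in _]/(tnth (in_tuple e) k \in e) eP => /asboolP.
Qed.

Section Tower.
Variables (I : finType) (p : I -> Gamma) (B : set X).
Hypothesis B_clopen : clopen B.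
Hypothesis p_disjoint : forall i j x y, B x -> B y ->
  alpha (p i) x = alpha (p j) y -> i = j.
Implicit Types pi rho : {perm I}.

(** The translate of [B] by [p i], written as a preimage so that it is clopen by continuity. *)
Let level i : set X := alpha (p i)^-1%g @^-1` B.

Let level_uniq i j x : level i x -> level j x -> i = j.
Proof. by move=> ix jx; apply: (p_disjoint ix jx); rewrite !hactVK. Qed.

Definition tower_fun pi x : X :=
  if [pick i | `[< level i x >]] is Some i
  then alpha (p (pi i) * (p i)^-1)%g x else x.

Lemma tower_funE pi i y : B y -> tower_fun pi (alpha (p i) y) = alpha (p (pi i)) y.
Proof.
move=> By; have li : level i (alpha (p i) y) by rewrite /level/= hactK.
rewrite /tower_fun; case: pickP => [j /asboolP lj|/(_ i)]; last by rewrite asboolT.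
by rewrite -(level_uniq li lj) hactM hactK.
Qed.

Lemma tower_fun_out pi x : (forall i y, B y -> x <> alpha (p i) y) -> tower_fun pi x = x.
Proof.
move=> out; rewrite /tower_fun; case: pickP => // i /asboolP li.
by case: (out i _ li); rewrite hactVK.
Qed.

Lemma tower_cases x : (exists i, exists2 y, B y & x = alpha (p i) y) \/
  (forall i y, B y -> x <> alpha (p i) y).
Proof.
have [h|h] := pselect (exists i, exists2 y, B y & x = alpha (p i) y); first by left.
by right=> i y By E; apply: h; exists i, y.
Qed.

Lemma tower_funM pi rho x : tower_fun (pi * rho)%g x = tower_fun rho (tower_fun pi x).
Proof.
have [[i [y By ->]]|out] := tower_cases x.
  by rewrite !tower_funE// permM.
by rewrite !tower_fun_out// tower_fun_out.
Qed.

Lemma tower_fun1 x : tower_fun 1%g x = x.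
Proof.
have [[i [y By ->]]|out] := tower_cases x; first by rewrite tower_funE// perm1.
by rewrite tower_fun_out.
Qed.

Let piece (o : option I) : set X :=
  if o is Some i then level i else [set x | forall i, ~ level i x].

Let piece_clopen o : clopen (piece o).
Proof.
case: o => [i|] /=; first exact: clopen_preimage_act.
by apply: clopen_forall => i; apply: clopenC => //; exact: clopen_preimage_act.
Qed.

Let piece_cover x : exists o, piece o x.
Proof.
have [[i li]|h] := pselect (exists i, level i x); first by exists (Some i).
by exists None => i li; apply: h; exists i.
Qed.

Let piece_uniq o o' x : piece o x -> piece o' x -> o = o'.
Proof.
case: o o' => [i|] [j|] //= h h'; first by rewrite (level_uniq h h').
  by case: (h' i).
by case: (h j).
Qed.

Let shift pi (o : option I) : Gamma :=
  if o is Some i then (p (pi i) * (p i)^-1)%g else 1%g.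

Let tower_piece pi o x : piece o x -> tower_fun pi x = alpha (shift pi o) x.
Proof.
case: o => [i|] /= h.
  by rewrite -{1}(hactVK (p i) x) tower_funE// hactM.
rewrite hact1 tower_fun_out// => i y By E.
by apply: (h i); rewrite /level/= E hactK.
Qed.

Let tower_continuous pi : continuous (tower_fun pi).
Proof.
move=> x; have [o ox] := piece_cover x.
have [oo _] := piece_clopen o.
have near : \forall z \near x, tower_fun pi z = alpha (shift pi o) z.
  have /open_nbhs_nbhs : open_nbhs x (piece o) by [].
  by apply: filterS => z; exact: tower_piece.
rewrite /continuous_at (tower_piece pi ox).
apply: (cvg_trans _ (@homeo_fun_continuous _ (alpha (shift pi o)) x)).
by apply: near_eq_cvg; apply: filterS near => z ->.
Qed.

Definition tower pi : homeo X :=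
  @Homeo X (tower_fun pi) (tower_fun pi^-1%g)
    (fun x => etrans (esym (tower_funM pi pi^-1%g x))
                (etrans (congr1 (tower_fun^~ x) (mulgV pi)) (tower_fun1 x)))
    (fun x => etrans (esym (tower_funM pi^-1%g pi x))
                (etrans (congr1 (tower_fun^~ x) (mulVg pi)) (tower_fun1 x)))
    (@tower_continuous pi) (@tower_continuous pi^-1%g).

Lemma towerE pi i y : B y -> tower pi (alpha (p i) y) = alpha (p (pi i)) y.
Proof. exact: tower_funE. Qed.

Lemma tower_out pi x : (forall i y, B y -> x <> alpha (p i) y) -> tower pi x = x.
Proof. exact: tower_fun_out. Qed.

Lemma towerM pi rho : tower (pi * rho)%g = (tower rho * tower pi)%g.
Proof. by apply: homeo_ext => x; exact: tower_funM. Qed.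

Lemma tower_full pi : full_group alpha (tower pi).
Proof.
apply: (@full_group_of_partition _ piece (shift pi)) => //.
by move=> o x; exact: tower_piece.
Qed.

End Tower.
End Towers.

Section SubgroupSets.
Variables (G : groupType) (H : set G).
Hypothesis HG : is_subgroup H.

Lemma subgroup1 : H 1%g.
Proof. by case: HG => /set_mem. Qed.

Lemma subgroupM x y : H x -> H y -> H (x * y)%g.
Proof.
by move=> Hx Hy; apply/set_mem/(group_closedM HG); apply/mem_set.
Qed.

End SubgroupSets.

Section ThreeCycles.
Variables (Gamma : groupType) (X : topologicalType).
Variable alpha : {multiplicative Gamma -> homeo X}.

Definition disjoint_translates (I : finType) (p : I -> Gamma) (B : set X) :=
  forall i j x y, B x -> B y -> alpha (p i) x = alpha (p j) y -> i = j.

Lemma tower_dynamical_S3 (p : 'I_3 -> Gamma) (B : set X) (cB : clopen B)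
    (dB : disjoint_translates p B) :
  dynamical_S3 alpha (tower cB dB).
Proof.
split; [exact: tower_full|exact: towerM|].
have img i : alpha (p i) @` B = alpha (p i)^-1%g @^-1` B.
  apply/seteqP; split=> x /=; first by move=> [y By <-]; rewrite hactK.
  by move=> By; exists (alpha (p i)^-1%g x) => //; rewrite hactVK.
exists (fun i => alpha (p i) @` B); split.
- by move=> i; rewrite img; exact: clopen_preimage_act.
- by move=> i j _ _ [x [[y By <-] [z Bz]]] /esym; exact: dB.
- move=> sigma x nx; apply: tower_out => i y By E; apply: nx.
  by exists i => //; exists y.
- move=> sigma i; split.
    exists (p (sigma i) * (p i)^-1)%g => _ [y By <-].
    by rewrite towerE// hactM hactK.
  apply/seteqP; split=> x /=.
    by move=> [_ [y By <-] <-]; exists y => //; exact/esym/towerE.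
  by move=> [y By <-]; exists (alpha (p i) y); [exists y|exact: towerE].
Qed.

(** The subtower on the levels [a], [b], [c] realizes a homomorphism as in the definition of the
    alternating group. The full tower agrees with it on this even permutation, since the remaining
    levels are fixed. *)
Lemma tower_three_cycle (I : finType) (p : I -> Gamma) (B : set X)
    (cB : clopen B) (dB : disjoint_translates p B) (a b c : I) :
  a != b -> a != c -> b != c ->
  dynamical_alternating_group alpha (tower cB dB (tperm a b * tperm a c)%g).
Proof.
move=> ab ac bc.
pose io (k : 'I_3) : I := nth a [:: a; b; c] k.
have io_inj : injective io.
  move=> k l /eqP; rewrite /io nth_uniq//= ?inE ?negb_or ?ab ?ac ?bc//.
  by move=> /eqP E; exact: val_inj.
have dB3 : disjoint_translates (p \o io) B.
  by move=> i j x y Bx By E; apply: io_inj; apply: (dB _ _ _ _ Bx By E).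
pose o0 : 'I_3 := @Ordinal 3 0 isT; pose o1 : 'I_3 := @Ordinal 3 1 isT.
pose o2 : 'I_3 := @Ordinal 3 2 isT.
pose sg : {perm 'I_3} := (tperm o0 o1 * tperm o0 o2)%g.
move=> H [HG HS]; apply: HS.
exists (tower cB dB3); first exact: tower_dynamical_S3.
exists sg; first by rewrite Alt_even odd_permM !odd_tperm.
apply: homeo_ext => x.
have [[i [y By ->]]|out] := tower_cases alpha p B x; last first.
  by rewrite !tower_out// => k y By; exact: out.
rewrite towerE// permM.
have [[k ->]|ni] := pselect (exists k, i = io k).
  rewrite -[a]/(io o0) -[b]/(io o1) -[c]/(io o2) -!inj_tperm// -permM.
  exact/esym/(towerE cB dB3).
have ne k : i <> io k by move=> E; apply: ni; exists k.
have neP k : io k != i by apply/eqP => E; exact: (ne k (esym E)).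
rewrite [tperm a b i]tpermD ?[tperm a c i]tpermD;
  try by [exact: (neP o0)|exact: (neP o1)|exact: (neP o2)].
apply/esym/tower_out => k z Bz E; apply: (ne k).
exact: dB By Bz E.
Qed.

(* The product of two disjoint transpositions of the levels is a product of two
   3-cycles. *)
Lemma tower_double_transposition (I : finType) (p : I -> Gamma) (B : set X)
    (cB : clopen B) (dB : disjoint_translates p B) (a b c d : I)
    (H : set (homeo X)) :
  is_subgroup H -> dynamical_alternating_group alpha `<=` H -> uniq [:: a; b; c; d] ->
  H (tower cB dB (tperm a b * tperm c d)%g).
Proof.
move=> HG AH; rewrite /= !inE !negb_or => /and4P[/and3P[ab ac ad] /andP[bc bd] cd _].
have -> : (tperm a b * tperm c d = (tperm a b * tperm a c) * (tperm a c * tperm c d))%g.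
  by rewrite mulgA -[(_ * _ * tperm a c)%g]mulgA tperm2 mulg1.
rewrite towerM; apply: (subgroupM HG); apply: AH.
  by rewrite [tperm a c]tpermC; apply: tower_three_cycle => //; rewrite eq_sym.
exact: tower_three_cycle.
Qed.

End ThreeCycles.

(** * Free points and their small neighbourhoods *)

Section FreePoints.
Variables (Gamma : groupType) (X : topologicalType).
Variable alpha : {multiplicative Gamma -> homeo X}.
Hypothesis X_zd : zero_dimensional X.

Definition free_point (x : X) := forall s : Gamma, alpha s x = x -> s = 1%g.

Lemma free_point_inj x s t : free_point x -> alpha s x = alpha t x -> s = t.
Proof.
move=> fx E; apply/esym/(mulgI s^-1)%g; rewrite mulVg.
by apply: fx; rewrite hactM -E hactK.
Qed.

Lemma disjoint_translates_exists (I : finType) (p : I -> Gamma) x :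
  free_point x -> injective p ->
  exists B, [/\ clopen B, B x & disjoint_translates alpha p B].
Proof.
move=> fx pinj.
pose Q (ij : I * I) (U : set X) := ij.1 <> ij.2 -> forall y z, U y -> U z ->
  alpha (p ij.1) y <> alpha (p ij.2) z.
have [|[i j]|B [cB Bx BQ]] := @clopen_common_nbhd X (I * I)%type x Q.
- by move=> ij U V UV VQ ne y z /UV Vy /UV Vz; exact: VQ.
- have [->|ij] := eqVneq i j; first by exists setT; split=> //; exact: clopenT.
  have /X_zd[U [cU Ui Uj]] : alpha (p i) x != alpha (p j) x.
    by apply/eqP => /(free_point_inj fx) /pinj E; rewrite E eqxx in ij.
  exists ((alpha (p i) @^-1` U) `&` (alpha (p j) @^-1` (~` U))); split=> //.
    apply: clopenI; apply: clopen_preimage_act => //.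
    exact: clopenC.
  by move=> _ y z /= [Uy _] [_ Uz] E; apply: Uz; rewrite -E.
exists B; split=> // i j y z By Bz E; apply: contrapT => ne.
by apply: (BQ (i, j)) E.
Qed.

Lemma full_group_cocycles g : full_group alpha g -> exists S : seq Gamma,
  forall x, exists k U, [/\ k \in S, clopen U, U x & forall y, U y -> g y = alpha k y].
Proof.
move=> [n [P [s [[Pcov _ _] cP gP]]]]; exists (codom s) => x.
have : cover [set: 'I_n] P x by rewrite Pcov.
by move=> [i _ Pix]; exists (s i), (P i); split; [exact: codom_f| | |exact: gP].
Qed.

Lemma full_group_cocycle g x : full_group alpha g -> exists k, g x = alpha k x.
Proof.
by move=> /full_group_cocycles[S /(_ x)[k [U [_ _ Ux /(_ x Ux)]]]]; exists k.
Qed.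

Hypothesis alpha_free : topologically_free alpha.

Lemma free_point_moved (g : homeo X) : g <> 1%g -> exists x, free_point x /\ g x <> x.
Proof.
move=> g1.
have [x gx] : exists x, g x <> x.
  apply: contrapT => h; apply: g1; apply: homeo_ext => x.
  by apply: contrapT => gx; apply: h; exists x.
have /X_zd[U [cU Ugx Ux]] : g x != x by exact/eqP.
have [| |y [[/= Ugy Uy] fy]] := @alpha_free ((g @^-1` U) `&` ~` U).
- by exists x.
- have [oU _] : clopen ((g @^-1` U) `&` ~` U).
    apply: clopenI; last exact: clopenC.
    by apply: preimage_clopen => //; exact: homeo_fun_continuous.
  exact: oU.
- by exists y; split=> // E; apply: Uy; rewrite -E.
Qed.

End FreePoints.

(** * Infinite conjugacy classes *)

Section ICC.
Variables (Gamma : groupType) (X : topologicalType).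
Variable alpha : {multiplicative Gamma -> homeo X}.
Hypothesis X_zd : zero_dimensional X.
Hypothesis alpha_free : topologically_free alpha.
Hypothesis Gamma_inf : infinite_set [set: Gamma].
Variable G : set (homeo X).
Hypothesis G_subgroup : is_subgroup G.
Hypothesis G_full : G `<=` full_group alpha.
Hypothesis G_alt : dynamical_alternating_group alpha `<=` G.

Lemma infinite_avoid (r : seq Gamma) : exists s, s \notin r.
Proof.
apply: contrapT => h; apply: Gamma_inf; apply/finite_seqP; exists r.
apply/seteqP; split=> // s _ /=; apply: contrapT => /negP sr.
by apply: h; exists s.
Qed.

(* A 3-cycle of the levels [k], [s], [r] of a tower whose level [1] contains
   [x] conjugates [g] to a map sending [x] to [alpha s x]. *)
Lemma conjugate_moves x (g : homeo X) (k s : Gamma) : free_point alpha x -> g x = alpha k x ->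
  1%g != k -> s \notin [:: 1%g; k] ->
  exists2 h, G h & (h * g * h^-1)%g x = alpha s x.
Proof.
move=> fx gx k1; rewrite !inE negb_or => /andP[s1 sk].
have [r] := infinite_avoid [:: 1%g; k; s].
rewrite !inE !negb_or => /and3P[r1 rk rs].
pose p (i : 'I_4) : Gamma := nth 1%g [:: 1%g; k; s; r] i.
have u : uniq [:: 1%g; k; s; r].
  rewrite /= !inE !negb_or k1 (eq_sym 1%g s) s1 (eq_sym 1%g r) r1.
  by rewrite (eq_sym k s) sk (eq_sym k r) rk (eq_sym s r) rs.
have pinj : injective p.
  by move=> i j /eqP; rewrite nth_uniq// => /eqP E; exact: val_inj.
have [B [cB Bx dB]] := disjoint_translates_exists X_zd fx pinj.
pose o0 : 'I_4 := @Ordinal 4 0 isT; pose o1 : 'I_4 := @Ordinal 4 1 isT.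
pose o2 : 'I_4 := @Ordinal 4 2 isT; pose o3 : 'I_4 := @Ordinal 4 3 isT.
pose c : {perm 'I_4} := (tperm o1 o2 * tperm o1 o3)%g.
pose h := tower cB dB c.
exists h; first by apply: G_alt; exact: tower_three_cycle.
have hE i : h (alpha (p i) x) = alpha (p (c i)) x by exact: towerE.
have x0 : x = alpha (p o0) x by rewrite hact1.
have hx : h x = x by rewrite {1}x0 hE permM !tpermD// -x0.
have hVx : (h^-1)%g x = x by rewrite -{1}hx; exact: homeo_funK.
rewrite -[LHS]/(h (g ((h^-1)%g x))) hVx gx -[k]/(p o1) hE permM tpermL tpermD//.
Qed.

(** At a free point [x] moved by [g], conjugates of [g] send [x] to [alpha s x] for all [s] but two,
    and these points are distinct. The group is infinite because it contains a nontrivial element, a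
    3-cycle of levels. *)
Lemma full_subgroup_ICC : [set: X] !=set0 -> ICC (subgroup_type G_subgroup).
Proof.
move=> [x00 _].
have conj_inf (g : subgroup_type G_subgroup) : g <> 1%g ->
    infinite_set (range (fun h => g ^ h)%g).
  move=> g1.
  have vg1 : val g <> 1%g by move=> E; apply: g1; apply: val_inj.
  have [x [fx gx]] := free_point_moved X_zd alpha_free vg1.
  have [k gk] := full_group_cocycle x (G_full (set_mem (valP g))).
  have k1 : 1%g != k by apply/eqP => E; apply: gx; rewrite gk -E hact1.
  move=> fin; apply: Gamma_inf.
  have fin2 : finite_set [set val c x | c in range (fun h => g ^ h)%g].
    exact: finite_image.
  have sub : [set alpha s x | s in [set s | s \notin [:: 1%g; k]]] `<=`
      [set val c x | c in range (fun h => g ^ h)%g].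
    move=> _ [s /= sn <-].
    have [h Gh E] := conjugate_moves fx gk k1 sn.
    pose h' : subgroup_type G_subgroup := Sub h (mem_set Gh).
    exists (g ^ h'^-1)%g; first by exists h'^-1%g.
    by rewrite conjgE invgK -E -mulgA.
  have fin3 : finite_set [set s | s \notin [:: 1%g; k]].
    have := sub_finite_set sub fin2.
    by rewrite (eq_finite_set (inj_card_eq _))// => s t _ _; exact: free_point_inj.
  have : finite_set ([set s | s \notin [:: 1%g; k]] `|` [set` [:: 1%g; k]]).
    by rewrite finite_setU; split=> //; apply/finite_seqP; exists [:: 1%g; k].
  apply: sub_finite_set => s _ /=.
  by case: (boolP (s \in [:: 1%g; k])) => h; [right|left].
split=> //.
have [x [_ fx]] : [set: X] `&` [set x | free_point alpha x] !=set0.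
  by apply: alpha_free; [exists x00|exact: openT].
have [k k1] := infinite_avoid [:: 1%g].
have [s sk] := infinite_avoid [:: 1%g; k].
move: k1 sk; rewrite !inE negb_or => k1 /andP[s1 sk].
pose p (i : 'I_3) : Gamma := nth 1%g [:: 1%g; k; s] i.
have u : uniq [:: 1%g; k; s].
  by rewrite /= !inE !negb_or (eq_sym 1%g k) k1 (eq_sym 1%g s) s1 (eq_sym k s) sk.
have pinj : injective p.
  by move=> i j /eqP; rewrite nth_uniq// => /eqP E; exact: val_inj.
have [B [cB Bx dB]] := disjoint_translates_exists X_zd fx pinj.
pose o0 : 'I_3 := @Ordinal 3 0 isT; pose o1 : 'I_3 := @Ordinal 3 1 isT.
pose o2 : 'I_3 := @Ordinal 3 2 isT.
pose h := tower cB dB (tperm o0 o1 * tperm o0 o2)%g.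
have Gh : G h by apply: G_alt; exact: tower_three_cycle.
have hx : h x = alpha k x.
  rewrite -{1}[x](hact1 alpha) -[1%g]/(p o0) towerE// permM tpermL tpermD//.
apply: sub_infinite_set (conj_inf (Sub h (mem_set Gh)) _) => //.
move=> /(congr1 val) /= h1; move: hx; rewrite h1 => /esym /fx k1'.
by rewrite k1' eqxx in k1.
Qed.

End ICC.

(** * Flips of towers over a Folner set *)

(** Lists [F] and then its complement, lists [f @: F] and then its complement, and matches
    positions. The partial map of indices induced by [g] thereby becomes the permutation that
    [folner_flips] asks for. *)
Lemma perm_extend (J : finType) (F : {set J}) (f : J -> J) :
  {in F &, injective f} -> exists s : {perm J}, {in F, s =1 f}.
Proof.
move=> finj; pose l1 := enum F ++ enum (~: F)%SET.
pose l2 := map f (enum F) ++ enum (~: (f @: F))%SET.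
have u1 : uniq l1.
  rewrite cat_uniq !enum_uniq andbT; apply/hasPn => j.
  by rewrite !mem_enum inE.
have u2 : uniq l2.
  rewrite cat_uniq enum_uniq andbT map_inj_in_uniq ?enum_uniq; last first.
    by move=> i j; rewrite !mem_enum; exact: finj.
  apply/hasPn => j; rewrite mem_enum inE; apply: contra => /mapP[i + ->].
  by rewrite mem_enum => iF; apply: imset_f.
have m1 j : j \in l1 by rewrite mem_cat !mem_enum inE orbN.
have s1 : size l1 = #|J|.
  by rewrite size_cat -!cardE cardsC.
have s2 : size l2 = #|J|.
  rewrite size_cat size_map -!cardE -(card_in_imset finj).
  by rewrite cardsC.
have lt j : (index j l1 < size l2)%N by rewrite s2 -s1 index_mem.
have ginj : injective (fun j => nth j l2 (index j l1)).
  move=> i j /eqP; rewrite (set_nth_default i j (lt j)) nth_uniq//.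
  by move=> /eqP E; rewrite -(nth_index i (m1 i)) E nth_index.
exists (perm ginj) => j jF; rewrite permE.
have jl : j \in enum F by rewrite mem_enum.
rewrite index_cat jl nth_cat size_map index_mem jl.
by rewrite (nth_map j) ?index_mem// nth_index.
Qed.

Section Flips.
Variable J : finType.
Local Notation I := (J * (bool * bool))%type.
Implicit Types b d : {set J}.

(** Each [j] carries four levels. The first bit is toggled and the second tells two pairs apart, so
    a flip at a single [j] is a product of two disjoint transpositions. *)
Definition flip_fun b (i : I) : I := (i.1, (i.2.1 (+) (i.1 \in b), i.2.2)).

Lemma flip_funK b : involutive (flip_fun b).
Proof. by move=> [j [u v]]; rewrite /flip_fun /= addbK. Qed.

Definition flip b : {perm I} := perm (inv_inj (flip_funK b)).

Lemma flipE b j u v : flip b (j, (u, v)) = (j, (u (+) (j \in b), v)).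
Proof. by rewrite permE. Qed.

Lemma flipM b d : flip (symd b d) = (flip b * flip d)%g.
Proof.
by apply/permP => -[j [u v]]; rewrite permM !flipE in_symd addbA.
Qed.

Lemma flip0 : flip finset.set0 = 1%g.
Proof. by apply/permP => -[j [u v]]; rewrite flipE perm1 inE addbF. Qed.

Lemma flip1 j : flip [set j]%SET =
  (tperm (j, (false, false)) (j, (true, false)) *
   tperm (j, (false, true)) (j, (true, true)))%g.
Proof.
apply/permP => -[i [u v]]; rewrite flipE permM inE.
have [->|ij] := eqVneq i j.
  have ne2 (w w' : bool * bool) : w != w' -> (j, w) != (j, w').
    by rewrite xpair_eqE eqxx.
  rewrite addbT; case: v.
    rewrite [tperm _ (j, (true, false)) _]tpermD ?ne2//; try by case: u.
    by case: u; rewrite ?tpermL ?tpermR.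
  by case: u; rewrite ?tpermL ?tpermR tpermD ?ne2.
have ne w : (j, w) != (i, (u, v)).
  by rewrite xpair_eqE eq_sym (negPf ij).
by rewrite addbF !tpermD ?ne.
Qed.

End Flips.

Lemma infinite_fiber (T : choiceType) (C : finType) (f : T -> C) :
  infinite_set [set: T] -> exists c, infinite_set [set t | f t = c].
Proof.
move=> Tinf; apply: contrapT => h; apply: Tinf.
rewrite (_ : setT = \bigcup_(c in [set: C]) [set t | f t = c]); last first.
  by apply/seteqP; split=> // t _; exists (f t).
apply: bigcup_finite => // c _; apply: contrapT => fc; apply: h; by exists c.
Qed.

Lemma infinite_set_avoid (T : choiceType) (A : set T) (r : seq T) :
  infinite_set A -> exists2 t, A t & t \notin r.
Proof.
move=> Ainf; apply: contrapT => h; apply: Ainf.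
have rfin : finite_set [set` r] by apply/finite_seqP; exists r.
apply: sub_finite_set rfin => t At /=; apply: contrapT => /negP tr.
by apply: h; exists t.
Qed.

(** The elements are picked one by one, each outside the finite set of all [b^-1 * a * t i] with
    [t i] chosen earlier. *)
Lemma spread_translates (Gamma : groupType) (A : set Gamma) (L : seq Gamma) (n : nat) :
  infinite_set A -> exists t : nat -> Gamma,
  (forall i, (i < n)%N -> A (t i)) /\
  (forall i j a b, (i < n)%N -> (j < n)%N -> a \in L -> b \in L ->
    (a * t i)%g = (b * t j)%g -> i = j).
Proof.
move=> Ainf; elim: n => [|n [t [tA tL]]]; first by exists (fun=> 1%g).
pose r := flatten [seq [seq (b^-1 * (a * t i))%g | b <- L, a <- L] | i <- iota 0 n].
have [u Au ur] := infinite_set_avoid r Ainf.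
have uP i a b : (i < n)%N -> a \in L -> b \in L -> (a * t i)%g <> (b * u)%g.
  move=> im aL bL E; case/negP: ur; apply/flattenP.
  exists [seq (b^-1 * (a * t i))%g | b <- L, a <- L].
    by apply: map_f; rewrite mem_iota.
  by apply/allpairsP; exists (b, a); rewrite /= E mulKg.
exists (fun i => if (i < n)%N then t i else u); split=> [i|i j a b].
  by rewrite ltnS; case: (ltnP i n) => // im _; exact: tA.
rewrite !ltnS => im jm aL bL; case: (ltnP i n) => hi; case: (ltnP j n) => hj.
- exact: tL.
- by move=> /uP; case.
- by move=> /esym /uP; case.
- by move=> _; apply/eqP; rewrite eqn_leq (leq_trans im)// (leq_trans jm).
Qed.

Section TowerFlips.
Variables (Gamma : groupType) (X : topologicalType).
Variable alpha : {multiplicative Gamma -> homeo X}.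
Variables (J : finType) (p : J * (bool * bool) -> Gamma) (B : set X).
Hypotheses (cB : clopen B) (dB : disjoint_translates alpha p B).

Lemma tower_flip_mem (H : set (homeo X)) b : is_subgroup H ->
  dynamical_alternating_group alpha `<=` H -> H (tower cB dB (flip b)).
Proof.
move=> HG AH; have [n bn] := ubnP #|b|; elim: n => // n IH in b bn *.
have [->|[j jb]] := finset.set_0Vmem b.
  rewrite flip0 (_ : tower cB dB 1%g = 1%g); first exact: subgroup1.
  by apply: homeo_ext => x; exact: tower_fun1.
rewrite -(symdK [set j]%SET b) flipM towerM; apply: (subgroupM HG).
  apply: IH; rewrite (_ : symd _ _ = (b :\ j)%SET).
    by move: bn; rewrite (cardsD1 j b) jb.
  apply/setP => i; rewrite in_symd !inE.
  by have [->|_] := eqVneq i j; rewrite ?jb.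
rewrite flip1; apply: tower_double_transposition => //=.
by rewrite !inE !xpair_eqE !eqxx.
Qed.

Lemma tower_flip_intertwine (g : homeo X) (F : {set J}) (s : {perm J}) (b : {set J}) :
  (forall j w y, j \in F -> B y -> g (alpha (p (j, w)) y) = alpha (p (s j, w)) y) ->
  b \subset F ->
  (g * tower cB dB (flip b) = tower cB dB (flip (s @: b)%SET) * g)%g.
Proof.
move=> gF /fintype.subsetP bF; apply: homeo_ext => x.
change (g (tower cB dB (flip b) x) = tower cB dB (flip (s @: b)%SET) (g x)).
have [[j [w [y [jF By ->]]]]|nx] :=
    pselect (exists j w y, [/\ j \in F, B y & x = alpha (p (j, w)) y]).
  case: w => u v; rewrite gF// !towerE// !flipE gF//.
  by rewrite mem_imset//; exact: perm_inj.
have fixes (d : {set J}) z : (forall j w y, j \in d -> B y -> z <> alpha (p (j, w)) y) ->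
    tower cB dB (flip d) z = z.
  move=> nz; have [[[j [u v]] [y By zE]]|out] := tower_cases alpha p B z; last first.
    exact: tower_out.
  rewrite zE towerE// flipE; suff /negbTE -> : j \notin d by rewrite addbF.
  by apply/negP => jd; exact: (nz _ _ _ jd By zE).
(* Off the levels over [F] neither flip acts: [g x] cannot lie on a level over [s @: b], because
   every such level is the image under [g] of a level over [b]. *)
rewrite !fixes// => j w y jd By E; apply: nx.
- move/imsetP: jd => [i ib ji]; exists i, w, y; split=> //; first exact: bF.
  apply: (can_inj (homeo_funK g)); rewrite E ji gF//; exact: bF.
- by exists j, w, y; split=> //; exact: bF.
Qed.

End TowerFlips.

Section FullGroupFlips.
Variables (R : realType) (Gamma : groupType) (X : topologicalType).
Variable alpha : {multiplicative Gamma -> homeo X}.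
Hypothesis X_zd : zero_dimensional X.
Hypothesis alpha_free : topologically_free alpha.
Hypothesis Gamma_inf : infinite_set [set: Gamma].
Hypothesis Gamma_countable : countable [set: Gamma].
Hypothesis Gamma_amenable : amenable R Gamma.
Variable G : set (homeo X).
Hypothesis G_subgroup : is_subgroup G.
Hypothesis G_full : G `<=` full_group alpha.
Hypothesis G_alt : dynamical_alternating_group alpha `<=` G.
Hypothesis X_nonempty : [set: X] !=set0.

Lemma full_subgroup_flips (E : seq (subgroup_type G_subgroup)) (delta : R) :
  0 < delta -> folner_flips E delta.
Proof.
move=> d0.
have [x0 [_ fx0]] : [set: X] `&` [set x | free_point alpha x] !=set0.
  by apply: alpha_free => //; exact: openT.
have /choice[S SP] : forall g : subgroup_type G_subgroup, exists S : seq Gamma,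
    forall x, exists k U, [/\ k \in S, clopen U, U x &
      forall y, U y -> val g y = alpha k y].
  by move=> g; apply: full_group_cocycles; exact: G_full (set_mem (valP g)).
pose K := flatten [seq S g | g <- E].
have /choice[kk kkP] : forall gs : subgroup_type G_subgroup * Gamma, exists k,
    exists U, [/\ k \in S gs.1, clopen U, U (alpha gs.2 x0) &
      forall y, U y -> val gs.1 y = alpha k y].
  by move=> [g s]; exact: SP.
have kkK g s : g \in E -> kk (g, s) \in K.
  move=> gE; have [U [kS _ _ _]] := kkP (g, s).
  by apply/flattenP; exists (S g) => //; exact: map_f.
(* Points leaving [F] are counted separately for each [k] in [K], hence the division by the size of
   [K]; the added 1 covers an empty [K]. *)
pose e := delta / (1 + (size K)%:R).
have e0 : 0 < e by rewrite divr_gt0// ltr_pwDl.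
have [F [uF oF sF FK]] := folner_odd K Gamma_inf Gamma_countable Gamma_amenable e0.
(* [L] must contain the images of the indices in [F] under every element of [E]. *)
pose L := F ++ [seq (k * s)%g | k <- K, s <- F].
pose J : finType := seq_sub L.
have FL s : s \in F -> s \in L by rewrite mem_cat => ->.
have KFL k s : k \in K -> s \in F -> (k * s)%g \in L.
  by move=> kK sF'; rewrite mem_cat; apply/orP; right; apply/allpairsP; exists (k, s).
(* The cocycles of all [g] in [E] at the points [s t x0], recorded as positions in [K]. There are
   finitely many patterns, so infinitely many [t] share one. *)
pose pat t : {ffun seq_sub E * seq_sub F -> 'I_(size K).+1} :=
  [ffun gs => inord (index (kk (ssval gs.1, (ssval gs.2 * t)%g)) K)].
have [c cinf] := infinite_fiber pat Gamma_inf.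
have [t [tc tL]] := spread_translates L 4 cinf.
pose T (w : bool * bool) : Gamma := t (w.1.*2 + w.2)%N.
have w4 (w : bool * bool) : (w.1.*2 + w.2 < 4)%N by case: w => [[] []].
have kT g s w w' : g \in E -> s \in F -> kk (g, (s * T w)%g) = kk (g, (s * T w')%g).
  move=> gE sF'; have : pat (T w) = pat (T w') by rewrite /T !tc.
  move=> /ffunP /(_ (SeqSub gE, SeqSub sF')); rewrite !ffunE /=.
  move=> /(congr1 (@nat_of_ord _)); rewrite !inordK ?ltnS ?index_size// => Ei.
  by rewrite -(nth_index 1%g (kkK g (s * T w)%g gE)) Ei nth_index// kkK.
pose q g s := kk (g, (s * T (false, false))%g).
pose p (i : J * (bool * bool)) : Gamma := (ssval i.1 * T i.2)%g.
have pinj : injective p.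
  move=> [j w] [j' w'] /[dup] Epp'; rewrite /p /= => Ep.
  have := tL _ _ _ _ (w4 w) (w4 w') (ssvalP j) (ssvalP j') Ep => Ew.
  have {}Ew : w = w' by move: w w' Ew {Ep Epp'} => [[] []] [[] []].
  by move: Ep; rewrite Ew => /mulIg /val_inj ->.
have [B0 [cB0 B0x dB0]] := disjoint_translates_exists X_zd fx0 pinj.
(* Near [x0] the cocycle of [g] is constant along each level, and by [kT] it is the same element for
   the four levels over [s]. *)
pose Q (i : seq_sub E * (seq_sub F * (bool * bool))) (U : set X) :=
  let: (g, (s, w)) := i in forall y, U y -> val (ssval g) (alpha (ssval s * T w)%g y) =
    alpha (q (ssval g) (ssval s) * (ssval s * T w))%g y.
have [||U [cU Ux UQ]] := @clopen_common_nbhd X _ x0 Q.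
- by move=> [g [s w]] U V UV VQ y /UV; exact: VQ.
- move=> [g [s w]]; have [U [_ cU Ux Ug]] := kkP (ssval g, (ssval s * T w)%g).
  exists (alpha (ssval s * T w)%g @^-1` U); split=> //; first exact: clopen_preimage_act.
  move=> y /= /Ug /= ->; rewrite [RHS]hactM; congr (homeo_fun (alpha _) _).
  exact: kT (ssvalP g) (ssvalP s).
pose B := B0 `&` U.
have cB : clopen B by exact: clopenI.
have Bx : B x0 by [].
have dB : disjoint_translates alpha p B.
  by move=> i j y z [By _] [Bz _]; exact: dB0.
pose h (b : {set J}) : subgroup_type G_subgroup :=
  Sub (tower cB dB (flip b)) (mem_set (tower_flip_mem cB dB b G_subgroup G_alt)).
pose FJ : {set J} := [set j | ssval j \in F]%SET.
have cFJ : #|FJ| = size F.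
  rewrite cardE -(size_map (fun j : J => ssval j)); apply/perm_size/uniq_perm => //.
    by rewrite map_inj_uniq ?enum_uniq//; exact: val_inj.
  move=> s; apply/mapP/idP => [[j + ->]|sF']; first by rewrite mem_enum inE.
  by exists (SeqSub (FL s sF')) => //; rewrite mem_enum inE.
exists J, h, FJ; split.
- move=> b d; apply: val_inj; rewrite /= symdC flipM.
  exact: towerM.
- move=> b d /(congr1 val) /= hbd; apply/setP => j.
  have := congr1 (fun f : homeo X => f (alpha (p (j, (false, false))) x0)) hbd.
  rewrite !towerE// !flipE => /(free_point_inj fx0)/pinj [].
  by case: (j \in b); case: (j \in d).
- by rewrite cFJ.
- rewrite cFJ; apply: le_trans sF _; rewrite ler_wpM2r// /e ler_pdivrMr ?ltr_pwDl//.
  by rewrite ler_peMr ?(ltW d0)// lerDl.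
move=> g gE.
have qL (j : J) : j \in FJ -> (q g (ssval j) * ssval j)%g \in L.
  by rewrite inE => jF; apply: KFL => //; exact: kkK.
(* By [qL] the default value of [insubd] does not occur on [FJ]. *)
pose sg (j : J) : J := insubd j (q g (ssval j) * ssval j)%g.
have sgE (j : J) : j \in FJ -> ssval (sg j) = (q g (ssval j) * ssval j)%g.
  by move=> jF; rewrite -[LHS]/(val (sg j)) val_insubd qL.
have gB j w y : j \in FJ -> B y ->
    val g (alpha (p (j, w)) y) = alpha (p (sg j, w)) y.
  rewrite {1}inE => jF By; rewrite /p /= sgE ?inE// -mulgA.
  have [_ Uy] := By.
  exact: (UQ (SeqSub gE, (SeqSub jF, w)) y Uy).
have sg_inj : {in FJ &, injective sg}.
  move=> i j iF jF E'; have := gB j (false, false) x0 jF Bx.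
  rewrite -E' -gB// => /(can_inj (homeo_funK (val g))) /(free_point_inj fx0) /pinj.
  by case.
have [s sE] := perm_extend sg_inj.
exists s => [b bF|].
  apply: val_inj => /=; apply: (tower_flip_intertwine cB dB) bF => j w y jF By.
  by rewrite sE// gB.
rewrite cFJ.
pose Lst := flatten [seq [seq (k * u)%g | u <- F & (k * u)%g \notin F] | k <- K].
have le1 : (#|(s @: FJ :\: FJ)%SET| <= size Lst)%N.
  rewrite cardE -(size_map (fun j : J => ssval j)); apply: uniq_leq_size.
    by rewrite map_inj_uniq ?enum_uniq//; exact: val_inj.
  move=> _ /mapP[j + ->]; rewrite mem_enum inE => /andP[jF /imsetP[i iF ji]].
  have Ej : ssval j = (q g (ssval i) * ssval i)%g by rewrite ji sE// sgE.
  apply/flattenP; exists [seq (q g (ssval i) * u)%g | u <- F & (q g (ssval i) * u)%g \notin F].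
    by apply: map_f; exact: kkK.
  apply/mapP; exists (ssval i) => //; rewrite mem_filter -Ej.
  by move: jF iF; rewrite !inE => -> ->.
have le2 : (size Lst)%:R <= (size K)%:R * (e * (size F)%:R).
  rewrite /Lst size_flatten /shape -map_comp sumnE big_map natr_sum.
  rewrite (_ : _ * _ = \sum_(k <- K) e * (size F)%:R); last first.
    by rewrite big_const_seq count_predT iter_addr_0 mulr_natl.
  rewrite big_seq [leRHS]big_seq; apply: ler_sum => k kK /=.
  by rewrite size_map size_filter; exact: FK.
rewrite -(ler_nat R) in le1; apply: le_trans le1 (le_trans le2 _).
rewrite mulrA ler_wpM2r// /e mulrCA ler_piMr ?(ltW d0)//.
by rewrite ler_pdivrMr ?ltr_pwDl// mul1r lerDr.
Qed.

End FullGroupFlips.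

(** * Countability of the topological full group *)

Section CantorCylinders.

Lemma cantor_coord_nbhs (y : cantor_space) (i : nat) :
  \forall z \near y, (z : nat -> bool) i = (y : nat -> bool) i.
Proof.
have : nbhs ((y : nat -> bool) i) [set (y : nat -> bool) i] by exact: discrete_set1.
exact: (@proj_continuous nat (fun=> bool) i y).
Qed.

(** The complement of [U] is compact and each of its points differs from [x] in some coordinate,
    which is an open condition; so finitely many coordinates suffice. *)
Lemma cantor_cylinder (x : cantor_space) (U : set cantor_space) : open U -> U x ->
  exists N, forall y : cantor_space,
    (forall i, (i < N)%N -> (y : nat -> bool) i = (x : nat -> bool) i) -> U y.
Proof.
move=> oU Ux.
have cK : compact (~` U).
  by apply: (subclosed_compact _ cantor_space_compact) => //; exact: open_closedC.
move/compact_near_coveringP in cK.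
pose P N (z : cantor_space) := exists2 i, (i < N)%N &
  (z : nat -> bool) i <> (x : nat -> bool) i.
suff [N _ /(_ N (leqnn N)) h] : \forall N \near \oo, ~` U `<=` P N.
  exists N => y yx; apply: contrapT => Uy.
  by have [i /yx] := h _ Uy.
apply: cK => y Uy.
have [i yi] : exists i, (y : nat -> bool) i <> (x : nat -> bool) i.
  apply: contrapT => h; apply: Uy; rewrite (_ : y = x)//.
  by apply/funext => i; apply: contrapT => yi; apply: h; exists i.
exists ([set z : cantor_space | (z : nat -> bool) i = (y : nat -> bool) i],
        [set N | (i < N)%N]).
  by split; [exact: cantor_coord_nbhs|exists i.+1].
by move=> [z N] /= [zi iN]; exists i; rewrite // zi.
Qed.

End CantorCylinders.

Section FullGroupCountable.
Variables (Gamma : groupType) (alpha : {multiplicative Gamma -> homeo cantor_space}).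
Hypothesis Gamma_countable : countable [set: Gamma].

Let agree N (x y : cantor_space) :=
  forall i, (i < N)%N -> (y : nat -> bool) i = (x : nat -> bool) i.

(** Compactness turns the locally constant cocycle into one read off from a fixed number of
    coordinates. *)
Lemma full_group_cylinder T : full_group alpha T -> exists N, forall x,
  exists k, forall y, agree N x y -> T y = alpha k y.
Proof.
move=> /full_group_cocycles[S SP].
have cT := cantor_space_compact; move/compact_near_coveringP in cT.
pose P N (x : cantor_space) := exists k, forall y, agree N x y -> T y = alpha k y.
suff [N _ /(_ N (leqnn N)) h] : \forall N \near \oo, [set: cantor_space] `<=` P N.
  by exists N => x; exact: h.
apply: cT => x _; have [k [U [_ [oU _] Ux Uk]]] := SP x.
have [M MU] := cantor_cylinder oU Ux.
exists ([set z | agree M x z], [set N | (M <= N)%N]).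
  split; last by exists M.
  elim: M {MU} => [|M IH]; first by apply: filterS filterT => z _ i.
  apply: filterS2 IH (cantor_coord_nbhs x M) => z zM zE i.
  by rewrite ltnS leq_eqVlt => /orP[/eqP ->|/zM].
move=> [z N] /= [zx MN]; exists k => y yz; apply: Uk; apply: MU => i im.
by rewrite yz ?zx// (leq_trans im).
Qed.

(** An element is determined by a length [N] and a table assigning to each word of length [N] the
    code of a group element; such tables form a countable set. *)
Lemma full_group_countable : countable (full_group alpha).
Proof.
have /countable_injP[phi phi_inj] := Gamma_countable.
pose codeN (N : nat) := {ffun N.-tuple bool -> nat}.
pose code := {N : nat & codeN N}.
pose prefix N (y : cantor_space) : N.-tuple bool := [tuple (y : nat -> bool) i | i < N].
pose coded (T : homeo cantor_space) (D : code) := forall y, exists2 k,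
  phi k = tagged D (prefix (tag D) y) & T y = alpha k y.
have /choice[f fP] : forall T, exists D, full_group alpha T -> coded T D.
  move=> T; have [/full_group_cylinder[N /choice[k kP]]|nT] :=
      pselect (full_group alpha T); last by exists (existT codeN 0%N [ffun _ => 0%N]).
  (* Padding a word with [false] gives a point of its cylinder, at which the group element is read
     off. *)
  pose ext (w : N.-tuple bool) : cantor_space := nth false w.
  exists (existT codeN N [ffun w => phi (k (ext w))]) => _ y.
  exists (k (ext (prefix N y))); first by rewrite /= ffunE.
  apply: kP => i iN; rewrite /ext.
  by have := tnth_nth false (prefix N y) (Ordinal iN) => /= <-; rewrite tnth_mktuple.
rewrite -(eq_countable (inj_card_eq (f := f) _)); first exact: countableP.
move=> T T' /set_mem/fP TD /set_mem/fP T'D fTT'; apply: homeo_ext => y.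
have [k kD ->] := TD y; have [k' k'D ->] := T'D y.
rewrite fTT' -k'D in kD.
by rewrite (phi_inj _ _ _ _ kD)// in_setT.
Qed.

End FullGroupCountable.

Theorem theorem5p5 (R : realType) (Gamma : groupType)
    (alpha : {multiplicative Gamma -> homeo cantor_space})
    (Gamma_countable : countable [set: Gamma])
    (Gamma_infinite : infinite_set [set: Gamma])
    (Gamma_amenable : amenable R Gamma)
    (alpha_free : topologically_free alpha)
    (G : set (homeo cantor_space)) (G_subgroup : is_subgroup G)
    (G_full : G `<=` full_group alpha)
    (G_alternating : dynamical_alternating_group alpha `<=` G) :
  property_Gamma R (subgroup_type G_subgroup).
Proof.
have X_nonempty : [set: cantor_space] !=set0 by exists (fun=> false).
split.
- have img : [set val g | g in [set: subgroup_type G_subgroup]] `<=` full_group alpha.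
    by move=> _ [g _ <-]; exact: G_full (set_mem (valP g)).
  rewrite -(eq_countable (inj_card_eq (f := val) _)); last first.
    by move=> g h _ _; exact: val_inj.
  apply: sub_countable (full_group_countable alpha Gamma_countable).
  exact: subset_card_le.
- exact: (full_subgroup_ICC cantor_zero_dimensional alpha_free).
- apply: factor_property_Gamma_of_flips => E delta.
  exact: (full_subgroup_flips cantor_zero_dimensional alpha_free Gamma_infinite
    Gamma_countable Gamma_amenable).
Qed.
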